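(* Let $K$ be a compact Hausdorff space and $X$ be a complex Banach space. Then $n_L(X)\le n_L(A(K,X))$.
   Context: All Banach spaces are complex. $C(K,X)$ is the Banach space of continuous functions $K\to X$ with the supremum norm, and $C(K)=C(K,\mathbb{C})$. A uniform algebra on $K$ is a closed subspace (subalgebra) of $C(K)$ that separates the points of $K$ and contains the constants. $A(K,X)$ denotes a closed subspace of $C(K,X)$ such that: (i) the base algebra $A=\{x^*\circ f: f\in A(K,X),\ x^*\in X^*\}$ is a uniform algebra; (ii) $A\otimes X\subset A(K,X)$ (i.e. $t\mapsto\varphi(t)x$ is in $A(K,X)$ for $\varphi\in A$, $x\in X$); (iii) $fg\in A(K,X)$ for every $f\in A$, $g\in A(K,X)$. For a Banach space $Z$, $\mathrm{Lip}_0(Z,Z)$ is the space of Lipschitz maps $T:Z\to Z$ with $T(0)=0$ and norm $\|T\|_L=\sup_{x\ne y}\|Tx-Ty\|/\|x-y\|$; $D(z)=\{z^*\in Z^*: z^*(z)=\|z^*\|\|z\|=\|z\|^2\}$; $\nu_L(T)=\sup\left\{\frac{|z^*(Tx-Ty)|}{\|x-y\|^2}: x\ne y \text{ in } Z,\ z^*\in D(x-y)\right\}$; and $n_L(Z)=\inf\{\nu_L(T): T\in\mathrm{Lip}_0(Z,Z),\ \|T\|_L=1\}$. *)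

(* Defs.v *)
From HB Require Import structures.
From mathcomp Require Import all_boot all_order all_algebra.
From mathcomp Require Import complex.
From mathcomp Require Import all_classical all_reals all_analysis.

Set Implicit Arguments.
Unset Strict Implicit.
Unset Printing Implicit Defensive.

Import Order.TTheory GRing.Theory Num.Theory.
Import numFieldNormedType.Exports.

Local Open Scope classical_set_scope.
Local Open Scope complex_scope.
Local Open Scope ring_scope.

(* In a [normedModType R[i]] the norm [`|x|] has values in [R[i]] (its imaginary
   part is zero); [rnorm] is the same norm read in [R]. *)
Definition rnorm (R : realType) (V : normedModType R[i]) (x : V) : R :=
  complex.Re `|x|.

Section RealNorm.
Context (R : realType) (V : normedModType R[i]).
Implicit Types x y : V.

Lemma rnormE x : (rnorm x)%:C = `|x|.
Proof. by apply/RRe_real; exact: normr_real. Qed.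

Lemma rnorm_ge0 x : 0 <= rnorm x.
Proof. by rewrite -lecR rnormE; exact: normr_ge0. Qed.

Lemma rnormD x y : rnorm (x + y) <= rnorm x + rnorm y.
Proof. by rewrite -lecR rmorphD /= !rnormE ler_normD. Qed.

Lemma rnorm_eq0 x : rnorm x = 0 -> x = 0.
Proof. by move=> x0; apply/normr0_eq0; rewrite -rnormE x0. Qed.

Lemma rnormZ (a : R[i]) x :
  rnorm (a *: x) = rnorm (a : R[i]^o) * rnorm x.
Proof.
by apply: complexI; rewrite rmorphM /= !rnormE normrZ.
Qed.

Lemma rnorm0 : rnorm (0 : V) = 0.
Proof. by rewrite /rnorm normr0. Qed.

End RealNorm.

(* [cfun cK X] is C(K, X). The compactness proof [cK] is a phantom parameter: it
   is what makes the supremum norm finite. *)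
Definition cfun (R : realType) (K : topologicalType) (cK : compact [set: K])
  (X : normedModType R[i]) : Type := continuousType K X.

Definition cfunc (R : realType) (K : topologicalType) (X : normedModType R[i]) :
  {pred K -> X} := mem [set f : K -> X | continuous f].

Section ContinuousFunctions.
Context (R : realType) (K : topologicalType) (cK : compact [set: K]).
Context (X : normedModType R[i]).
Notation C := (cfun cK X).

Definition mkcfun (f : K -> X) (cf : continuous f) : C :=
  (mkcts cf : continuousType K X).

Lemma mkcfun_subproof (f : K -> X) : f \in @cfunc R K X -> continuous f.
Proof. by rewrite inE. Qed.

Lemma cfun_rect (P : C -> Type) :
  (forall f (cf : f \in @cfunc R K X), P (mkcfun (mkcfun_subproof cf))) ->
  forall u, P u.
Proof.
move=> Psub [f [[cf]]].
have cf' : f \in @cfunc R K X by rewrite inE.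
by have -> : cf = mkcfun_subproof cf' by []; exact: Psub.
Qed.

Lemma cfun_valK f (cf : f \in @cfunc R K X) :
  mkcfun (mkcfun_subproof cf) = f :> (K -> X).
Proof. by []. Qed.

HB.instance Definition _ := isSub.Build _ _ C cfun_rect cfun_valK.
HB.instance Definition _ := [Choice of C by <:].

Lemma cfunc_submod_closed : submod_closed (@cfunc R K X).
Proof.
split; first by rewrite inE => x; exact: cvg_cst.
move=> a f g; rewrite !inE => cf cg x.
by apply: cvgD; [apply: cvgZr; exact: cf|exact: cg].
Qed.

HB.instance Definition _ :=
  GRing.isSubmodClosed.Build _ _ (@cfunc R K X) cfunc_submod_closed.
HB.instance Definition _ := [SubChoice_isSubLmodule of C by <:].

Definition supnorm (f : C) : R := sup (range (fun t => rnorm (f t))).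

Lemma cfunDE (f g : C) t : (f + g) t = f t + g t.
Proof. by []. Qed.

Lemma cfunZE a (f : C) t : (a *: f) t = a *: f t.
Proof. by []. Qed.

End ContinuousFunctions.

Lemma rnorm_continuous (R : realType) (V : normedModType R[i]) :
  continuous (@rnorm R V).
Proof.
move=> x; apply/cvgrPdist_lt => e e0.
have eC0 : 0 < e%:C by rewrite ltcR.
have /cvgrPdist_lt /(_ _ eC0) : y @[y --> x] --> x by exact: cvg_id.
apply: filterS => y; rewrite -rnormE ltcR; apply: le_lt_trans.
have H (u v : V) : rnorm u - rnorm v <= rnorm (u - v).
  by rewrite lerBlDr -{1}(subrK v u) rnormD.
rewrite ler_norml H andbT lerNl opprB.
by rewrite -[leRHS]/(complex.Re _) distrC -/(rnorm _) H.
Qed.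

Section SupNorm.
Context (R : realType) (K : topologicalType) (cK : compact [set: K]).
Context (X : normedModType R[i]).
Implicit Types f g : cfun cK X.

Lemma cfun_continuous f : continuous f.
Proof. exact: (@cts_fun K X f). Qed.

Lemma supnorm_has_ubound f : has_ubound (range (fun t => rnorm (f t))).
Proof.
have : compact (range (fun t => rnorm (f t))).
  apply: continuous_compact => //; apply: continuous_subspaceT => t.
  by apply: continuous_comp; [exact: cfun_continuous|exact: rnorm_continuous].
move=> /compact_bounded[M [_ MP]]; exists (M + 1) => y Ay.
by rewrite (le_trans (ler_norm _)) ?(MP (M + 1)) ?ltrDl.
Qed.

Lemma rnorm_le_supnorm f t : rnorm (f t) <= supnorm f.
Proof. by apply: (ub_le_sup (supnorm_has_ubound f)); exists t. Qed.

Lemma sup_range0 (h : K -> R) : ~ (exists t : K, True) -> sup (range h) = 0.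
Proof.
move=> K0; suff -> : range h = set0 by rewrite sup0.
by apply/seteqP; split => // y [t _ _]; apply: K0; exists t.
Qed.

Lemma supnorm_ge0 f : 0 <= supnorm f.
Proof.
have [[t _]|K0] := pselect (exists t : K, True).
  by rewrite (le_trans _ (rnorm_le_supnorm f t)) ?rnorm_ge0.
by rewrite /supnorm sup_range0.
Qed.

Lemma supnorm_le f (M : R) :
  0 <= M -> (forall t, rnorm (f t) <= M) -> supnorm f <= M.
Proof.
move=> M0 fM; have [[t _]|K0] := pselect (exists t : K, True).
  by apply: ge_sup => [|_ [s _ <-]//]; exists (rnorm (f t)), t.
by rewrite /supnorm sup_range0.
Qed.

Lemma supnormD f g : supnorm (f + g) <= supnorm f + supnorm g.
Proof.
apply: supnorm_le => [|t]; first by rewrite addr_ge0 ?supnorm_ge0.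
by rewrite cfunDE (le_trans (rnormD _ _)) // lerD ?rnorm_le_supnorm.
Qed.

Lemma supnormZ_le (a : R[i]) f :
  supnorm (a *: f) <= rnorm (a : R[i]^o) * supnorm f.
Proof.
apply: supnorm_le => [|t]; first by rewrite mulr_ge0 ?supnorm_ge0 ?rnorm_ge0.
rewrite cfunZE rnormZ.
by rewrite ler_wpM2l ?rnorm_ge0 ?rnorm_le_supnorm.
Qed.

Lemma supnormZ (a : R[i]) f :
  supnorm (a *: f) = rnorm (a : R[i]^o) * supnorm f.
Proof.
apply/eqP; rewrite eq_le supnormZ_le /=.
have [->|a0] := eqVneq a 0; first by rewrite rnorm0 mul0r supnorm_ge0.
have aV : rnorm (a : R[i]^o) * rnorm (a^-1 : R[i]^o) = 1.
  rewrite -rnormZ (_ : a *: _ = 1) ?/rnorm ?normr1 //.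
  by rewrite -[LHS]/(a * a^-1) mulfV.
rewrite -[leRHS]mul1r -aV -mulrA ler_wpM2l ?rnorm_ge0 //.
by rewrite -{1}[f](scalerK a0) supnormZ_le.
Qed.

Lemma supnorm_eq0 f : supnorm f = 0 -> f = 0.
Proof.
move=> f0; apply/val_inj/funext => t; apply: rnorm_eq0.
by apply/eqP; rewrite eq_le rnorm_ge0 andbT -f0; exact: rnorm_le_supnorm.
Qed.

Let cnorm f : R[i] := (supnorm f)%:C.

Let cnormD f g : cnorm (f + g) <= cnorm f + cnorm g.
Proof. by rewrite /cnorm -rmorphD lecR; exact: supnormD. Qed.

Let cnormZ (a : R[i]) f : cnorm (a *: f) = `|a| * cnorm f.
Proof. by rewrite /cnorm supnormZ rmorphM /= rnormE. Qed.

Let cnorm_eq0 f : cnorm f = 0 -> f = 0.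
Proof. by move=> /complexI; exact: supnorm_eq0. Qed.

HB.instance Definition _ :=
  Lmodule_isNormed.Build R[i] (cfun cK X) cnormD cnormZ cnorm_eq0.

Lemma rnorm_cfunE f : rnorm f = sup (range (fun t => rnorm (f t))).
Proof. by []. Qed.

End SupNorm.

(* A linear subspace as a normed space of its own, with the inherited norm. *)
Definition subspace_of (F : numFieldType) (V : normedModType F)
  (S : submodClosed V) : Type := {x : V | x \in S}.

Section Subspace.
Context (F : numFieldType) (V : normedModType F) (S : submodClosed V).
Notation W := (subspace_of S).

HB.instance Definition _ := SubChoice.on W.
HB.instance Definition _ := [SubChoice_isSubLmodule of W by <:].

Let snorm (x : W) : F := `|\val x|.

Let snormD (x y : W) : snorm (x + y) <= snorm x + snorm y.
Proof. exact: ler_normD. Qed.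

Let snormZ a (x : W) : snorm (a *: x) = `|a| * snorm x.
Proof. exact: normrZ. Qed.

Let snorm_eq0 (x : W) : snorm x = 0 -> x = 0.
Proof. by move=> /normr0_eq0 x0; exact: val_inj. Qed.

HB.instance Definition _ :=
  Lmodule_isNormed.Build F W snormD snormZ snorm_eq0.

End Subspace.

Section LipschitzNumericalIndex.
Context (R : realType) (Z : normedModType R[i]).
Implicit Types (x y z : Z) (phi : {linear Z -> R[i]^o}) (T : Z -> Z).

Definition continuous_dual : set {linear Z -> R[i]^o} := [set phi | continuous phi].

Definition dual_norm phi : R :=
  sup [set rnorm (phi z) | z in [set z | rnorm z <= 1]].

Definition duality_set z : set {linear Z -> R[i]^o} :=
  [set phi | continuous_dual phi /\
     phi z = (dual_norm phi * rnorm z)%:C /\ phi z = (rnorm z ^+ 2)%:C].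

Definition Lip0 : set (Z -> Z) := [set T | lipschitz T /\ T 0 = 0].

Definition lip_norm T : \bar R :=
  ereal_sup [set r | exists x y, x != y /\
    r = (rnorm (T x - T y) / rnorm (x - y))%:E].

Definition lip_numerical_radius T : \bar R :=
  ereal_sup [set r | exists x y phi, [/\ x != y, duality_set (x - y) phi &
    r = (rnorm (phi (T x - T y)) / rnorm (x - y) ^+ 2)%:E]].

(* With values in [\bar R]: the infimum of the empty family, which only occurs
   for Z = {0}, is +oo. *)
Definition lip_numerical_index : \bar R :=
  ereal_inf [set lip_numerical_radius T | T in
    [set T | Lip0 T /\ lip_norm T = 1%E]].

End LipschitzNumericalIndex.
Arguments lip_numerical_index {R} Z.

Section FunctionSpaces.
Context (R : realType) (K : topologicalType) (cK : compact [set: K]).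

Section Operations.
Context (X : normedModType R[i]).

Lemma cfun_cst_subproof (x : X) : continuous (fun _ : K => x).
Proof. by move=> t; exact: cvg_cst. Qed.

Definition cfun_cst (x : X) : cfun cK X := mkcfun cK (@cfun_cst_subproof x).

Lemma cfun_scale_subproof (g : cfun cK R[i]^o) (f : cfun cK X) :
  continuous (fun t => g t *: f t).
Proof. by move=> t; apply: cvgZ; exact: cfun_continuous. Qed.

(* t |-> g(t) f(t). For X = R[i]^o this is the product of C(K), since the scalar
   action of R[i] on R[i]^o is multiplication. *)
Definition cfun_scale (g : cfun cK R[i]^o) (f : cfun cK X) : cfun cK X :=
  mkcfun cK (@cfun_scale_subproof g f).

Definition base_algebra (A : {pred cfun cK X}) : set (cfun cK R[i]^o) :=
  [set g | exists f phi, [/\ f \in A, continuous_dual phi & forall t, g t = phi (f t)]].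

End Operations.

Record uniform_algebra (B : set (cfun cK R[i]^o)) : Prop := UniformAlgebra {
  ualg_closed : closed B;
  ualg_linear : forall a f g, B f -> B g -> B (a *: f + g);
  ualg_mul : forall f g, B f -> B g -> B (cfun_scale f g);
  ualg_separates : forall s t, s != t -> exists2 f, B f & f s != f t;
  ualg_cst : forall c, B (cfun_cst c)
}.

(* A is one of the spaces A(K, X); its linearity is part of its type, and
   [cfun_scale g (cfun_cst x)] is the elementary tensor t |-> g(t) x. *)
Record vector_function_space (X : normedModType R[i]) (A : submodClosed (cfun cK X)) :
    Prop := VectorFunctionSpace {
  vfs_closed : closed [set` A];
  vfs_ualg : uniform_algebra (base_algebra A);
  vfs_tensor : forall g x, base_algebra A g -> cfun_scale g (cfun_cst x) \in A;
  vfs_mul : forall g f, base_algebra A g -> f \in A -> cfun_scale g f \in A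
}.

End FunctionSpaces.

(* Main.v *)
Require Import Defs.
From HB Require Import structures.
From mathcomp Require Import all_boot all_order all_algebra.
From mathcomp Require Import complex.
From mathcomp Require Import all_classical all_reals all_analysis.
From mathcomp Require Import ring lra.

(** Let T on A(K, X) have Lipschitz norm 1, and let F, G satisfy
    |T F - T G| > k |F - G| with k < 1 close to 1; put h = F - G.  A peak function of
    the base algebra at a point t0 where T F - T G nearly attains its norm, composed with
    suitable polynomials, gives phi and psi in the base algebra with phi(t0) = 1,
    |phi| + |psi| <= 1 and psi h + phi h(t0) close to h.  If x1 in X has norm |h| and
    h(t0) = c x1 with 0 <= c <= 1, and x1* is a norm-one functional norming x1, then
    x |-> +- x1*(x) / |h| psi h + phi x are isometric embeddings of X which evaluation at
    t0 inverts, and psi h + phi h(t0) is the sum of a vector from each of them, the norms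
    adding up to |h|.  So T nearly attains its norm on a segment inside a translate of an
    isometric copy of X, and following T by evaluation at t0 gives a Lipschitz map of X
    with norm at least k and numerical radius at most that of T.

    The peak point is found without the Choquet boundary: a point of K at which the
    value vector of finitely many functions is farthest from the origin is a peak point,
    and adding a large constant to the function that norms T F - T G makes T F - T G
    nearly attain its norm there.  The polynomials iterate w |-> w - w^2 + w^3, which
    maps the disc |w|^2 <= Re w into itself and attracts its points to 0, except 1. *)

Set Implicit Arguments.
Unset Strict Implicit.
Unset Printing Implicit Defensive.
Import Order.TTheory GRing.Theory Num.Theory.
Import numFieldNormedType.Exports.
Local Open Scope classical_set_scope.
Local Open Scope complex_scope.
Local Open Scope ring_scope.

(** * The Hahn-Banach theorem over the complex numbers *)

Section HahnBanach.
Context {R : realType} {V : normedModType R[i]}.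
Implicit Types (x y : V) (p q : V -> R) (c t : R).

Definition sublinear p :=
  (forall x y, p (x + y) <= p x + p y) /\
  (forall c x, 0 < c -> p (c%:C *: x) <= c * p x).

Lemma sublinearZ p c x : sublinear p -> 0 < c -> p (c%:C *: x) = c * p x.
Proof.
move=> [_ pZ] c0; apply/eqP; rewrite eq_le pZ //=.
have cV0 : 0 < c^-1 by rewrite invr_gt0.
have := pZ _ (c%:C *: x) cV0.
rewrite scalerA -rmorphM mulVf ?gt_eqF // scale1r => h.
by rewrite -ler_pdivlMl.
Qed.

Lemma sublinear0 p : sublinear p -> p 0 = 0.
Proof.
move=> sp; have := sublinearZ 0 sp (ltr0n R 2); rewrite scaler0 => h; lra.
Qed.

Lemma sublinearN p x : sublinear p -> - p (- x) <= p x.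
Proof.
move=> sp; have := sp.1 x (- x); rewrite subrr (sublinear0 sp) => h; lra.
Qed.

(** For sublinear [p] it lies below [p] and is at most [- p y] at [- y], so a linear functional
    below it agrees with [p] at [y]. *)
Definition tilt p y x : R :=
  inf [set p (x + t%:C *: y) - t * p y | t in [set t | 0 <= t]].

Lemma sublinearZ0 p t x : sublinear p -> 0 <= t -> p (t%:C *: x) = t * p x.
Proof.
move=> sp; rewrite le_eqVlt => /orP[/eqP <-|/(sublinearZ x sp)//].
by rewrite scale0r mul0r sublinear0.
Qed.

Lemma tilt_le p y x t : sublinear p -> 0 <= t ->
  tilt p y x <= p (x + t%:C *: y) - t * p y.
Proof.
move=> sp t0; apply: ge_inf; last by exists t.
exists (- p (- x)) => _ [s s0 <-].
have := sp.1 (x + s%:C *: y) (- x).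
rewrite addrAC subrr add0r (sublinearZ0 y sp s0) => h; lra.
Qed.

Lemma le_tilt p y x (m : R) :
  (forall t, 0 <= t -> m <= p (x + t%:C *: y) - t * p y) -> m <= tilt p y x.
Proof.
move=> h; apply: lb_le_inf; first by exists (p (x + 0%:C *: y) - 0 * p y), 0 => /=.
by move=> _ [t t0 <-]; exact: h.
Qed.

Lemma sublinear_tilt p y : sublinear p -> sublinear (tilt p y).
Proof.
move=> sp; split=> [x1 x2|c x c0].
  rewrite -lerBlDr; apply: le_tilt => t t0; rewrite lerBlDr -lerBlDl.
  apply: le_tilt => s s0; rewrite lerBlDl.
  apply: le_trans (tilt_le _ _ sp (addr_ge0 t0 s0)) _.
  have := sp.1 (x1 + t%:C *: y) (x2 + s%:C *: y).
  rewrite addrACA -scalerDl -rmorphD => h; lra.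
rewrite -ler_pdivrMl //; apply: le_tilt => t t0; rewrite ler_pdivrMl //.
apply: le_trans (tilt_le _ _ sp (mulr_ge0 (ltW c0) t0)) _.
by rewrite rmorphM -scalerA -scalerDr (sublinearZ _ sp c0) mulrBr mulrA.
Qed.

Lemma tilt_le_self p y x : sublinear p -> tilt p y x <= p x.
Proof.
move=> sp; have := tilt_le y x sp (lexx 0).
by rewrite scale0r addr0 mul0r subr0.
Qed.

(* König's proof: a minimal sublinear functional is linear, since it coincides
   with each of its tilts. *)
Lemma minimal_sublinear q : sublinear q -> exists p,
  [/\ sublinear p, forall x, p x <= q x &
      forall p', sublinear p' -> (forall x, p' x <= p x) -> p' = p].
Proof.
move=> sq; pose T := {p : V -> R | sublinear p /\ forall x, p x <= q x}.
pose q0 : T := exist _ q (conj sq (fun x => lexx (q x))).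
have eqT (a b : T) : sval a = sval b -> a = b.
  case: a b => [a Pa] [b Pb] /= ab; subst b; congr exist; exact: Prop_irrelevance.
pose ge (a b : T) := `[< forall x, sval b x <= sval a x >].
have [| | |B totB|[p [sp pq]] pmin] := @Zorn T ge.
- by move=> a; apply/asboolP.
- move=> a b c /asboolP ba /asboolP cb; apply/asboolP => x.
  exact: le_trans (cb x) (ba x).
- move=> a b /asboolP ba /asboolP ab; apply: eqT; apply/funext => x.
  by apply: le_anti; rewrite ba ab.
(* The empty chain is bounded by [q0]: an infimum over it would be a default value, possibly above
   [q]. *)
- have [[b0 Bb0]|B0] := pselect (exists b, B b); last first.
    by exists q0 => s Bs; case: B0; exists s.
  pose m x := inf [set sval b x | b in B].
  have m_le b x : B b -> m x <= sval b x.
    move=> Bb; apply: ge_inf; last by exists b.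
    exists (- q (- x)) => _ [b' Bb' <-]; case: b' Bb' => [p [sp pq]] _ /=.
    by have := sublinearN x sp; have := pq (- x) => ? ?; lra.
  have le_m (z : R) x : (forall b, B b -> z <= sval b x) -> z <= m x.
    move=> h; apply: lb_le_inf; first by exists (sval b0 x), b0.
    by move=> _ [b Bb <-]; exact: h.
  have sm : sublinear m.
    split=> [x y|c x c0].
      rewrite -lerBlDr; apply: (le_m) => b Bb; rewrite lerBlDr -lerBlDl.
      apply: le_m => b' Bb'; rewrite lerBlDl.
      have [/asboolP bb'|/asboolP b'b] := totB _ _ Bb Bb'.
        apply: le_trans (m_le _ _ Bb') _.
        apply: le_trans ((svalP b').1.1 x y) _.
        by rewrite lerD2r; exact: bb'.
      apply: le_trans (m_le _ _ Bb) _.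
      apply: le_trans ((svalP b).1.1 x y) _.
      by rewrite lerD2l; exact: b'b.
    rewrite -ler_pdivrMl //; apply: le_m => b Bb; rewrite ler_pdivrMl //.
    exact: le_trans (m_le _ _ Bb) ((svalP b).1.2 _ _ c0).
  have mq x : m x <= q x.
    exact: le_trans (m_le _ x Bb0) ((svalP b0).2 x).
  by exists (exist _ m (conj sm mq)) => s Bs; apply/asboolP => x; exact: m_le.
exists p; split=> // p' sp' p'p.
have p'q x : p' x <= q x by exact: le_trans (p'p x) (pq x).
by have /(congr1 sval) := pmin (exist _ p' (conj sp' p'q)) (asboolT p'p).
Qed.

(** Minimality forces [p = tilt p y] for every [y], and the bound at [t = 1] makes [p]
    superadditive. Starting below [tilt q x0] forces the value at [x0]. *)
Lemma real_hahn_banach q x0 : sublinear q -> exists f : V -> R,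
  [/\ forall x y, f (x + y) = f x + f y, forall c x, f (c%:C *: x) = c * f x,
      forall x, f x <= q x & f x0 = q x0].
Proof.
move=> sq; have [p [sp pq pmin]] := minimal_sublinear (sublinear_tilt x0 sq).
have pD x y : p (x + y) = p x + p y.
  apply/eqP; rewrite eq_le sp.1 /=.
  have /(congr1 (@^~ x)) /= <- :=
    pmin _ (sublinear_tilt y sp) (fun z => tilt_le_self y z sp).
  by have := tilt_le y x sp ler01; rewrite scale1r mul1r => h; lra.
have pN x : p (- x) = - p x.
  by have := pD x (- x); rewrite subrr (sublinear0 sp) => h; lra.
have p_le x : p x <= q x by exact: le_trans (pq x) (tilt_le_self x0 x sq).
exists p; split=> //.
  move=> c x; have [c0|c0] := leP 0 c; first exact: sublinearZ0.
  rewrite -[c]opprK rmorphN scaleNr pN sublinearZ0 ?mulNr ?oppr_ge0//.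
  exact: ltW.
apply/eqP; rewrite eq_le p_le /=.
have := le_trans (pq (- x0)) (tilt_le x0 (- x0) sq ler01).
by rewrite scale1r addNr (sublinear0 sq) pN mul1r sub0r lerN2.
Qed.

Lemma contraction_continuous {W : normedModType R[i]} (f : {linear V -> W}) :
  (forall x, rnorm (f x) <= rnorm x) -> continuous f.
Proof.
move=> fle x; apply/cvgrPdist_lt => e e0.
have /cvgrPdist_lt /(_ _ e0) : y @[y --> x] --> x by exact: cvg_id.
apply: filterS => y; apply: le_lt_trans.
by rewrite -linearB -!rnormE lecR.
Qed.

Lemma rnormN x : rnorm (- x) = rnorm x.
Proof. by rewrite /rnorm normrN. Qed.

Lemma rnorm_distC x y : rnorm (x - y) = rnorm (y - x).
Proof. by rewrite /rnorm distrC. Qed.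

Lemma sqr_rnorm (z : R[i]) :
  rnorm (z : R[i]^o) ^+ 2 = complex.Re z ^+ 2 + complex.Im z ^+ 2.
Proof.
by rewrite /rnorm normc_def /= sqr_sqrtr // addr_ge0 ?sqr_ge0.
Qed.

Lemma rnormM (z w : R[i]) :
  rnorm (z * w : R[i]^o) = rnorm (z : R[i]^o) * rnorm (w : R[i]^o).
Proof. exact: (rnormZ z (w : R[i]^o)). Qed.

Lemma rnormR c : rnorm (c%:C : R[i]^o) = `|c|.
Proof. by rewrite /rnorm normc_def /= expr0n addr0 sqrtr_sqr. Qed.

Lemma Re_le_rnorm (z : R[i]) : complex.Re z <= rnorm (z : R[i]^o).
Proof.
have [z0|/ltW z0] := leP (complex.Re z) 0; first exact: le_trans z0 (rnorm_ge0 _).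
by rewrite -(ler_pXn2r (ltn0Sn 1)) ?nnegrE ?rnorm_ge0 // sqr_rnorm lerDl sqr_ge0.
Qed.

Lemma rnorm_gt0 x : x != 0 -> 0 < rnorm x.
Proof.
move=> x0; rewrite lt_neqAle rnorm_ge0 andbT eq_sym.
by apply: contra x0 => /eqP /rnorm_eq0 ->.
Qed.

Lemma rnormZR (c : R) x : 0 <= c -> rnorm (c%:C *: x) = c * rnorm x.
Proof. by move=> c0; rewrite rnormZ rnormR ger0_norm. Qed.

Lemma hahn_banach x0 : exists phi : {linear V -> R[i]^o},
  [/\ continuous phi, forall x, rnorm (phi x) <= rnorm x &
      phi x0 = (rnorm x0)%:C].
Proof.
have sq : sublinear (@rnorm R V).
  split=> [x y|c x c0]; first exact: rnormD.
  by rewrite rnormZ rnormR gtr0_norm.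
have [f [fD fZ fle fx0]] := real_hahn_banach x0 sq.
pose g x : R[i]^o := f x -i* f ('i%C *: x).
have gL : linear g.
  move=> [a b] x y.
  have fab z : f ((a +i* b) *: z) = a * f z + b * f ('i%C *: z).
    rewrite -!fZ -fD scalerA -scalerDl; congr (f (_ *: _)).
    by simpc.
  have fiab z : f ('i%C *: ((a +i* b) *: z)) = a * f ('i%C *: z) - b * f z.
    rewrite scalerA [X in f (X *: _)](_ : _ = (- b) +i* a); last by simpc.
    rewrite -!fZ -[in RHS]mulN1r -fZ -fD !scalerA -scalerDl; congr (f (_ *: _)).
    by simpc.
  rewrite /g scalerDr !fD fab fiab; apply/eqP; rewrite eq_complex /=.
  by apply/andP; split; apply/eqP; ring.
pose G : {linear V -> R[i]^o} := HB.pack g (GRing.isLinear.Build _ _ _ _ g gL).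
have Gle x : rnorm (G x) <= rnorm x.
  have [->|G0] := eqVneq (rnorm (G x)) 0; first exact: rnorm_ge0.
  have Gp : 0 < rnorm (G x) by rewrite lt_neqAle eq_sym G0 rnorm_ge0.
  rewrite -(ler_pM2l Gp) -expr2 sqr_rnorm.
  (* Multiplying [x] by the conjugate of [G x] turns |G x|^2 into a value of [f], which the norm
     bounds. *)
  have -> : complex.Re (G x) ^+ 2 + complex.Im (G x) ^+ 2
      = f (conjc (G x) *: x).
    have /(congr1 (fun z : R[i] => complex.Re z)) /= -> := linearZZ G (conjc (G x)) x.
    by rewrite /=; ring.
  apply: le_trans (fle _) _; rewrite rnormZ.
  suff -> : rnorm (conjc (G x) : R[i]^o) = rnorm (G x) by [].
  apply/eqP; rewrite -(eqrXn2 (ltn0Sn 1)) ?rnorm_ge0 // !sqr_rnorm /=.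
  by rewrite sqrrN.
exists G; split=> //; first exact: contraction_continuous.
(* The real part of [G x0] already attains the norm bound, so the imaginary part vanishes. *)
have := Gle x0; rewrite -(ler_pXn2r (ltn0Sn 1)) ?nnegrE ?rnorm_ge0 // sqr_rnorm /=.
rewrite fx0 gerDl sqrrN => h.
have /eqP : f ('i%C *: x0) ^+ 2 = 0 by apply: le_anti; rewrite h sqr_ge0.
rewrite sqrf_eq0 => /eqP h0.
by rewrite /g h0 fx0 oppr0.
Qed.

End HahnBanach.

(** * Pairs of polynomials on the unit disc, peaking at 1 *)

Section StolzPair.
Context {R : realType}.
Implicit Types (z w : R[i]) (d e x y : R) (n : nat).

Local Notation cnorm z := (rnorm (z : R[i]^o)).

(** The closed disc with diameter [0, 1], tangent to the unit circle at 1. *)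
Definition horodisc w := cnorm w ^+ 2 <= complex.Re w.

(** Over a ring, because it is iterated on complex numbers, on reals and on polynomials. Its complex
    fixed points are 0 and 1. *)
Definition horo_step {S : pzRingType} (w : S) : S := w - w ^+ 2 + w ^+ 3.

Lemma cnorm1 : cnorm (1 : R[i]) = 1.
Proof. by rewrite (rnormR (1 : R)) normr1. Qed.

Lemma cnormX z n : cnorm (z ^+ n) = cnorm z ^+ n.
Proof.
elim: n => [|n IHn]; first by rewrite !expr0 cnorm1.
by rewrite !exprS rnormM IHn.
Qed.

Lemma horodisc_half z : cnorm z <= 1 -> horodisc ((1 + z) / 2).
Proof.
move=> z1; have := exprn_ile1 2 (rnorm_ge0 _) z1.
have e2 : (2 : R[i])^-1 = (2^-1)%:C by rewrite fmorphV rmorph_nat.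
by rewrite /horodisc e2 !sqr_rnorm; case: z {z1} => x y /= h; nra.
Qed.

Lemma horodisc_le1 w : horodisc w -> cnorm w <= 1.
Proof.
rewrite /horodisc => h; have := le_trans h (Re_le_rnorm w).
by have := rnorm_ge0 (w : R[i]^o) => ? ?; nra.
Qed.

(** Since |w|^2 + |1 - w|^2 = 1 + 2 (|w|^2 - Re w), this amounts to membership in the disc. *)
Lemma horodisc_pair w : horodisc w ->
  cnorm (w ^+ 2) + cnorm ((1 - w) ^+ 2) <= 1.
Proof. by rewrite /horodisc !cnormX !sqr_rnorm; case: w => x y /= h; nra. Qed.

Lemma horodisc_step w : horodisc w -> horodisc (horo_step w).
Proof.
rewrite /horodisc /horo_step !sqr_rnorm.
have -> : w - w ^+ 2 + w ^+ 3 = w * (1 - w + w * w) by ring.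
case: w => x y /=.
set c := x ^+ 2 + y ^+ 2 => cx.
have xc : x ^+ 2 <= c by rewrite lerDl sqr_ge0.
(* With [x] the real part of w, the left side is the squared modulus of the step and the right side
   its real part. *)
have key : c * (1 - c + c ^+ 2 - 2 * x + 4 * x ^+ 2 - 2 * c * x)
    <= x - 2 * x ^+ 2 + c + 4 * x ^+ 3 - 3 * x * c.
  have x0 : 0 <= x by apply: le_trans cx; rewrite addr_ge0 ?sqr_ge0.
  have x1 : x <= 1 by nra.
  rewrite -subr_ge0.
  rewrite [leRHS](_ : _ = x * (1 - x) ^+ 2
      + (x - c) * (c ^+ 2 - (1 + x) * c + 3 * x ^+ 2)); last by ring.
  have h1 : 0 <= x - c by rewrite subr_ge0.
  (* The quadratic in [c] decreases for [c <= x] and equals x (3 x - 1) at [c = x], whence the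
     threshold; below it the first summand compensates. *)
  have [?|?] := leP (1 / 3) x.
    have : 0 <= c ^+ 2 - (1 + x) * c + 3 * x ^+ 2 by nra.
    nra.
  have : 0 <= c * (x - c) by rewrite mulr_ge0 // (le_trans _ xc) ?sqr_ge0.
  nra.
rewrite [leLHS](_ : _ = c * (1 - c + c ^+ 2 - 2 * x + 4 * x ^+ 2 - 2 * c * x));
  last by rewrite /c; ring.
by apply: le_trans key _; rewrite le_eqVlt; apply/orP; left; apply/eqP; rewrite /c; ring.
Qed.

Lemma horner_iter_step (q : {poly R[i]}) z n :
  (iter n horo_step q).[z] = iter n horo_step q.[z].
Proof. by elim: n => //= n <-; rewrite /horo_step !hornerE. Qed.

Lemma horodisc_iter w n : horodisc w -> horodisc (iter n horo_step w).
Proof. by move=> hw; elim: n => //= n; exact: horodisc_step. Qed.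

Lemma horo_step_lip w w' : horodisc w -> horodisc w' ->
  cnorm (horo_step w - horo_step w') <= 6 * cnorm (w - w').
Proof.
move=> /horodisc_le1 h /horodisc_le1 h'.
have -> : horo_step w - horo_step w' =
    (w - w') * (1 - w - w' + w * w + w * w' + w' * w').
  by rewrite /horo_step; ring.
rewrite rnormM mulrC ler_wpM2r ?rnorm_ge0 //.
have D (u v : R[i]) x y : cnorm u <= x -> cnorm v <= y -> cnorm (u + v) <= x + y.
  by move=> ux vy; apply: le_trans (rnormD _ _) _; exact: lerD.
have N (u : R[i]) x : cnorm u <= x -> cnorm (- u) <= x by rewrite /rnorm normrN.
have M (u v : R[i]) : cnorm u <= 1 -> cnorm v <= 1 -> cnorm (u * v) <= 1.
  by move=> u1 v1; rewrite rnormM mulr_ile1 ?rnorm_ge0.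
rewrite (_ : 6 = 1 + 1 + 1 + 1 + 1 + 1); last by ring.
by do 5 (apply: (D); last by [exact: M|exact: N]); rewrite cnorm1.
Qed.

Lemma horo_step_real x : horo_step x%:C = (horo_step x)%:C.
Proof. by rewrite /horo_step !(rmorphB, rmorphD, rmorphXn). Qed.

Lemma iter_step_real x n : iter n horo_step x%:C = (iter n horo_step x)%:C.
Proof. by elim: n => //= n ->; exact: horo_step_real. Qed.

(** On [0, 1/2] one has x^3 <= x^2 / 2, so a step is at most x (1 - x / 2), which gives decay like 2
    / n; the shift by 4 covers [n = 0]. *)
Lemma iter_step_small x0 n (x := iter n horo_step x0) :
  0 <= x0 <= 1 / 2 -> 0 <= x <= 1 / 2 /\ x * (n + 4)%:R <= 2.
Proof.
move=> x0h; rewrite /x; elim: n {x} => [|n].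
  by rewrite add0n; case/andP: x0h => h0 h1; split; [apply/andP|rewrite [X in X * _](_ : _ = x0) //; nra].
rewrite iterS addSn -(natr1 (n + 4)%N); move: (iter n _ _) => {x0 x0h} x.
set m : R := (n + 4)%:R => -[/andP[x0 x1] xm].
have xx : 0 <= x ^+ 2 * (1 / 2 - x) by rewrite mulr_ge0 ?sqr_ge0 ?subr_ge0.
have le1 : horo_step x <= x * (1 - x / 2) by rewrite /horo_step; lra.
have ge0 : 0 <= horo_step x.
  rewrite (_ : horo_step x = x * (1 - x) + x ^+ 3); last by rewrite /horo_step; ring.
  have x1' : 0 <= 1 - x by lra.
  by apply: addr_ge0; [exact: mulr_ge0|exact: exprn_ge0].
split; first by apply/andP; split=> //; apply: le_trans le1 _; nra.
have m0 : 0 <= m + 1 by rewrite addr_ge0 ?ler0n.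
apply: le_trans (ler_wpM2r m0 le1) _.
have h : 0 <= (2 - x * m) * (1 - x / 2) by apply: mulr_ge0; lra.
by have x2 := sqr_ge0 x; lra.
Qed.

Lemma expr_small x e : 0 <= x -> x < 1 -> 0 < e -> exists n, x ^+ n <= e.
Proof.
move=> x0 x1 e0.
have /cvg_expr /cvgrPdist_le /(_ _ e0) [N _ /(_ N (leqnn N))] :
  `|x| < 1 by rewrite ger0_norm.
by rewrite sub0r normrN ger0_norm ?exprn_ge0 // => h; exists N.
Qed.

Lemma horo_iter_lip w w' n : horodisc w -> horodisc w' ->
  cnorm (iter n horo_step w - iter n horo_step w') <= 6 ^+ n * cnorm (w - w').
Proof.
move=> hw hw'; elim: n => [|n IHn]; first by rewrite mul1r.
rewrite exprS -mulrA; apply: le_trans (horo_step_lip _ _) _.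
- exact: horodisc_iter.
- exact: horodisc_iter.
- by rewrite ler_wpM2l.
Qed.

(** Parallelogram identity: |(1 + z) / 2|^2 + |(1 - z) / 2|^2 = (1 + |z|^2) / 2. *)
Lemma midpoint_small z d : cnorm z <= 1 -> d <= cnorm (z - 1) -> 0 < d ->
  cnorm ((1 + z) / 2) ^+ 2 <= 1 - d ^+ 2 / 4.
Proof.
move=> z1 dz d0; have : d ^+ 2 <= cnorm (z - 1) ^+ 2.
  by rewrite ler_pXn2r ?nnegrE ?rnorm_ge0 // ltW.
have := exprn_ile1 2 (rnorm_ge0 _) z1.
have e2 : (2 : R[i])^-1 = (2^-1)%:C by rewrite fmorphV rmorph_nat.
by rewrite e2 !sqr_rnorm; case: z {z1 dz} => x y /= ? ?; nra.
Qed.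

(** A high power of (1 + z) / 2 is 1 at 1 and negligible away from 1. Averaging it with 1 gives
    values near 1/2 there, which iteration of [horo_step] brings close to 0, while 1 stays fixed. *)
Lemma horodisc_peak d e : 0 < d -> 0 < e -> exists W : {poly R[i]},
  [/\ forall z, cnorm z <= 1 -> horodisc W.[z], W.[1] = 1 &
      forall z, cnorm z <= 1 -> d <= cnorm (z - 1) -> cnorm W.[z] <= e].
Proof.
move=> d0 e0.
have e4 : 0 <= 4 / e by rewrite divr_ge0 ?ltW.
pose n := Num.bound (4 / e).
have en : 4 <= e * n%:R by rewrite mulrC -ler_pdivrMr // ltW ?archi_boundP.
pose q := Num.max 0 (1 - d ^+ 2 / 4).
have q1 : q < 1 by rewrite gt_max ltr01 gtrBl divr_gt0 ?exprn_gt0.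
have q0 : 0 <= q by rewrite le_max lexx.
(* [m] is chosen after [n]: the power must absorb the Lipschitz constant [6 ^+ n] of the iterate. *)
have [m qm] := expr_small q0 q1 (divr_gt0 e0 (exprn_gt0 n (ltr0n R 6))).
pose h : R[i] := 2^-1.
pose W0 : {poly R[i]} := (1 + ((1 + 'X) * h%:P) ^+ (2 * m)) * h%:P.
have W0E z : W0.[z] = (1 + ((1 + z) / 2) ^+ (2 * m)) / 2 by rewrite /W0 !hornerE.
have hh : h = (1 / 2)%:C by rewrite div1r fmorphV rmorph_nat.
exists (iter n horo_step W0); split=> [z z1| |z z1 dz].
- rewrite horner_iter_step W0E; apply/horodisc_iter/horodisc_half.
  by rewrite cnormX exprn_ile1 ?rnorm_ge0 ?horodisc_le1 ?horodisc_half.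
- have h11 : (1 + 1) / 2 = 1 :> R[i] by rewrite divff // pnatr_eq0.
  rewrite horner_iter_step W0E h11 expr1n h11.
  by elim: n {en qm} => //= k ->; rewrite /horo_step !expr1n subrr add0r.
rewrite horner_iter_step W0E; set v := _ ^+ (2 * m).
have vq : cnorm v <= e / 6 ^+ n.
  apply: le_trans qm; rewrite /v cnormX exprM lerXn2r ?nnegrE ?exprn_ge0 ?rnorm_ge0 //.
  by apply: le_trans (midpoint_small z1 dz d0) _; rewrite le_max lexx orbT.
have hv : cnorm v <= 1.
  by rewrite /v cnormX exprn_ile1 ?rnorm_ge0 ?horodisc_le1 ?horodisc_half.
have half0 : horodisc h.
  by have := @horodisc_half 0; rewrite rnorm0 addr0 mul1r; apply.
have := horo_iter_lip n (horodisc_half hv) half0.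
rewrite [(1 + v) / 2 - h](_ : _ = (1 / 2)%:C * v); last first.
  by rewrite -hh /h mulrDl mul1r addrAC subrr add0r mulrC.
rewrite rnormM rnormR hh iter_step_real.
set u := iter n _ _; set x := iter n _ _ => ux.
have [/andP[x0 _]] : 0 <= x <= 1 / 2 /\ x * (n + 4)%:R <= 2.
  by apply: iter_step_small; rewrite lexx andbT.
rewrite natrD => xn.
rewrite -[u](subrK x%:C); apply: le_trans (rnormD _ _) _.
rewrite rnormR (ger0_norm x0).
have xe : x <= e / 2.
  have n0 : 0 < n%:R + 4 :> R by rewrite ltr_wpDl.
  rewrite -(ler_pM2r n0); apply: le_trans xn _; nra.
have : 6 ^+ n * (`|1 / 2| * cnorm v) <= e / 2.
  rewrite ger0_norm // mulrCA div1r mulrC ler_pM2r ?invr_gt0 //.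
  by rewrite mulrC -ler_pdivlMr // exprn_gt0.
lra.
Qed.

Lemma horner_bounded (p : {poly R[i]}) : exists2 M, 0 < M &
  forall z, cnorm z <= 1 -> cnorm p.[z] <= M.
Proof.
elim/poly_ind: p => [|p c [M M0 pM]].
  by exists 1 => // z _; rewrite horner0 rnorm0.
exists (M + cnorm c) => [|z z1]; first by rewrite ltr_pwDl ?rnorm_ge0.
rewrite !hornerE; apply: le_trans (rnormD _ _) _.
by rewrite lerD2r rnormM -[M]mulr1 ler_pM ?rnorm_ge0 ?pM.
Qed.

Lemma horner_near1 (p : {poly R[i]}) e : 0 < e -> exists2 d, 0 < d &
  forall z, cnorm z <= 1 -> cnorm (z - 1) <= d -> cnorm (p.[z] - p.[1]) <= e.
Proof.
move=> e0; have /factor_theorem[q pq] : root (p - p.[1]%:P) 1.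
  by rewrite rootE !hornerE subrr.
have [M M0 qM] := horner_bounded q.
exists (e / M) => [|z z1 zd]; first exact: divr_gt0.
have := congr1 (horner^~ z) pq; rewrite !hornerE => ->.
by rewrite rnormM -[e](divfK (lt0r_neq0 M0)) mulrC ler_pM ?rnorm_ge0 ?qM.
Qed.

(** The defect equals 2 w (w - 1), so it is small near 0 and near 1 alike. *)
Lemma horodisc_pair_defect w : horodisc w ->
  cnorm (w ^+ 2 + (1 - w) ^+ 2 - 1) <= 2 * Num.min (cnorm w) (cnorm (w - 1)).
Proof.
move=> hw; have w1 := horodisc_le1 hw.
have w1' : cnorm (w - 1) <= 1.
  have := le_trans _ (horodisc_pair hw) => /(_ (cnorm ((1 - w) ^+ 2))).
  rewrite lerDr rnorm_ge0 => /(_ isT).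
  rewrite cnormX rnorm_distC => h.
  by rewrite -(ler_pXn2r (ltn0Sn 1)) ?nnegrE ?rnorm_ge0 // expr1n.
have -> : w ^+ 2 + (1 - w) ^+ 2 - 1 = 2%:C * (w * (w - 1)).
  by rewrite rmorph_nat; ring.
rewrite !rnormM rnormR ger0_norm // ler_wpM2l // le_min.
by rewrite ler_piMr ?rnorm_ge0 // ler_piMl ?rnorm_ge0.
Qed.

(** [P] and [S] add up the squares of [W] and of [1 - W] for polynomials [W] peaking at ever smaller
    scales. At a given point at most one [W] is far from both 0 and 1, so apart from small errors
    the defects total at most 2, which is negligible against [n]. *)
Lemma stolz_pair_sum d e n : 0 < d -> 0 < e -> exists (P S : {poly R[i]}) d',
  [/\ 0 < d' <= d, P.[1] = n%:R &
      forall z, cnorm z <= 1 ->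
      [/\ cnorm P.[z] + cnorm S.[z] <= n%:R,
          d <= cnorm (z - 1) -> cnorm P.[z] <= n%:R * e,
          cnorm (z - 1) <= d' -> cnorm (P.[z] + S.[z] - n%:R) <= n%:R * e &
          cnorm (P.[z] + S.[z] - n%:R) <= n%:R * e + 2]].
Proof.
move=> d0 e0; elim: n => [|n [P [S [d' [/andP[d'0 d'd] P1 PS]]]]].
  exists 0, 0, d; rewrite d0 lexx; split=> // [|z _]; first by rewrite horner0.
  by rewrite !horner0 addr0 subrr rnorm0 addr0 mul0r add0r ler0n.
have e20 : 0 < e / 2 by rewrite divr_gt0.
have [W [hW W1 We]] := horodisc_peak d'0 e20.
have [d'' d''0 W''] := horner_near1 W e20.
exists (P + W ^+ 2), (S + (1 - W) ^+ 2), (Num.min d' d'').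
split; first by rewrite lt_min d'0 d''0 ge_min d'd.
  by rewrite !hornerE W1 P1 expr1n natr1.
move=> z z1; have [PS1 Pd PSd' PS2] := PS z z1.
have hw := hW z z1.
have -> : (P + W ^+ 2).[z] = P.[z] + W.[z] ^+ 2 by rewrite !hornerE.
have -> : (S + (1 - W) ^+ 2).[z] = S.[z] + (1 - W.[z]) ^+ 2 by rewrite !hornerE.
set w := W.[z] in hw *; set p := P.[z] in PS1 Pd PSd' PS2 *.
set s := S.[z] in PS1 Pd PSd' PS2 *.
have pair1 := horodisc_pair hw; have defect := horodisc_pair_defect hw.
have defect2 : cnorm (w ^+ 2 + (1 - w) ^+ 2 - 1) <= 2.
  apply: le_trans defect _; rewrite -[leRHS]mulr1 ler_wpM2l // ge_min.
  by rewrite horodisc_le1.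
have split_sum : cnorm (p + w ^+ 2 + (s + (1 - w) ^+ 2) - n.+1%:R) <=
    cnorm (p + s - n%:R) + cnorm (w ^+ 2 + (1 - w) ^+ 2 - 1).
  rewrite (_ : _ - n.+1%:R = p + s - n%:R + (w ^+ 2 + (1 - w) ^+ 2 - 1)).
    exact: rnormD.
  by rewrite -natr1; ring.
move: split_sum; rewrite -!(natr1 n) => split_sum; rewrite !mulrDl !mul1r.
have far : d' <= cnorm (z - 1) ->
    cnorm (w ^+ 2) <= e /\ cnorm (w ^+ 2 + (1 - w) ^+ 2 - 1) <= e.
  move=> /(We z z1) we; split.
    rewrite cnormX expr2; apply: le_trans (_ : e / 2 * 1 <= e); last by lra.
    by rewrite ler_pM ?rnorm_ge0 ?horodisc_le1.
  apply: le_trans defect _; rewrite mulrC -ler_pdivlMr // ge_min.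
  by rewrite we.
split.
- have := rnormD (p : R[i]^o) (w ^+ 2).
  have := rnormD (s : R[i]^o) ((1 - w) ^+ 2).
  by lra.
- move=> dz; have [w2 _] := far (le_trans d'd dz).
  by apply: le_trans (rnormD _ _) _; rewrite lerD ?Pd.
- rewrite le_min => /andP[zd' zd'']; apply: le_trans split_sum _.
  rewrite lerD ?PSd' //; apply: le_trans defect _.
  rewrite mulrC -ler_pdivlMr // ge_min -W1 W'' ?orbT //.
- apply: le_trans split_sum _.
  (* Beyond [d'] the new defect is small, within it the old one is; the allowance of 2 pays for the
     other. *)
  have [/far[_ ?]|/ltW/PSd' ?] := leP d' (cnorm (z - 1)); last by lra.
  by lra.
Qed.

(* Two elements of the algebra generated by z that behave like a point mass and
   its complement: they replace the peak functions with values in a Stolz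
   region. *)
Lemma stolz_pair d e : 0 < d -> 0 < e -> exists P S : {poly R[i]}, P.[1] = 1 /\
  forall z, cnorm z <= 1 ->
  [/\ cnorm P.[z] + cnorm S.[z] <= 1, cnorm (P.[z] + S.[z] - 1) <= e &
      d <= cnorm (z - 1) -> cnorm P.[z] <= e].
Proof.
move=> d0 e0; have e20 : 0 < e / 2 by rewrite divr_gt0.
have e4 : 0 <= 4 / e by rewrite divr_ge0 ?ltW.
(* After division by [n] the error [n * (e / 2) + 2] is at most [e]; the successor makes [n]
   positive. *)
pose n := (Num.bound (4 / e)).+1.
have en : 4 <= e * n%:R.
  rewrite mulrC -ler_pdivrMr // ltW // (lt_le_trans (archi_boundP e4)) //.
  by rewrite ler_nat.
have n0 : 0 < n%:R :> R by rewrite ltr0n.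
have [P [S [d' [_ P1 PS]]]] := stolz_pair_sum n d0 e20.
pose c : R[i] := n%:R^-1.
have cn : c * n%:R = 1 by rewrite mulVf // pnatr_eq0.
have nc : cnorm c = n%:R^-1.
  have -> : c = (n%:R^-1)%:C by rewrite fmorphV rmorph_nat.
  by rewrite rnormR ger0_norm // invr_ge0 ltW.
exists (c *: P), (c *: S); split; first by rewrite hornerZ P1.
move=> z z1; have [PS1 Pd _ PS2] := PS z z1; rewrite !hornerZ !rnormM nc.
split.
- by rewrite -mulrDr mulrC ler_pdivrMr // mul1r.
- rewrite -cn -mulrDr -mulrBr rnormM nc mulrC ler_pdivrMr //.
  by apply: le_trans PS2 _; lra.
- move=> /Pd h; rewrite mulrC ler_pdivrMr //; apply: le_trans h _.
  by rewrite mulrC ler_pM2r //; lra.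
Qed.

End StolzPair.

(** * Peak points of finite families of functions *)

Section PeakFunctions.
Context {R : realType} {K : topologicalType} {cK : compact [set: K]}.

Local Notation cnorm z := (rnorm (z : R[i]^o)).
Local Notation C := (cfun cK R[i]^o).

Definition sqdist (s : seq C) (t t0 : K) : R :=
  \sum_(g <- s) cnorm (g t - g t0) ^+ 2.

Definition sqsum (s : seq C) (t : K) : R := \sum_(g <- s) cnorm (g t) ^+ 2.

Lemma sqsum_continuous s : continuous (sqsum s).
Proof.
rewrite /sqsum; elim: s => [|g s IHs] t.
  rewrite (_ : (fun _ => _) = (fun=> 0)); first exact: cvg_cst.
  by apply/funext => u; rewrite big_nil.
rewrite (_ : (fun _ => _) =
    (fun u => cnorm (g u) * cnorm (g u) + \sum_(h <- s) cnorm (h u) ^+ 2)).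
  rewrite /continuous_at; apply: cvgD; last exact: IHs.
  by apply: cvgM; (apply: continuous_comp;
    [exact: cfun_continuous|exact: rnorm_continuous]).
by apply/funext => u; rewrite big_cons expr2.
Qed.

Lemma sqsum_ge0 s t : 0 <= sqsum s t.
Proof. by apply: sumr_ge0 => g _; rewrite sqr_ge0. Qed.

Lemma continuous_max (t1 : K) (f : K -> R) : continuous f ->
  exists t0, forall t, f t <= f t0.
Proof.
move=> cf; have [||t0 _ t0P] := @compact_EVT_max K R f setT _ cK.
- by exists t1.
- exact: continuous_subspaceT.
- by exists t0 => t; apply: t0P; rewrite inE.
Qed.

Section UniformAlgebra.
Context {B : set C} (hB : uniform_algebra B).

Lemma ualgD f g : B f -> B g -> B (f + g).
Proof. by move=> Bf Bg; rewrite -[f]scale1r; exact: (ualg_linear hB). Qed.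

Lemma ualg_horner f (p : {poly R[i]}) : B f ->
  exists2 g, B g & forall t, g t = p.[f t].
Proof.
move=> Bf; elim/poly_ind: p => [|p c [g Bg gE]].
  exists (cfun_cst cK (0 : R[i]^o)); first exact: ualg_cst.
  by move=> t; rewrite horner0.
exists (cfun_scale f g + cfun_cst cK (c : R[i]^o)).
  by apply: ualgD; [exact: (ualg_mul hB)|exact: ualg_cst].
by move=> t; rewrite hornerMXaddC -gE mulrC.
Qed.

(** [h] is t |-> <v(t), v(t0)> for the vector v of values of [s]; conjugates fall on constants only,
    so [h] stays in [B]. The two formulas expand |v(t) - l v(t0)|^2 >= 0 and |v(t) - v(t0)|^2. *)
Lemma inner_product_fun (s : seq C) (t0 : K) : (forall g, g \in s -> B g) ->
  exists h, [/\ B h, h t0 = (sqsum s t0)%:C &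
    forall t (l : R[i]), 0 <= sqsum s t - 2 * complex.Re (conjc l * h t)
       + cnorm l ^+ 2 * sqsum s t0 /\
    (sqdist s t t0 = sqsum s t - 2 * complex.Re (h t) + sqsum s t0)].
Proof.
rewrite /sqdist /sqsum; elim: s => [|g s IHs] Bs.
  exists (cfun_cst cK (0 : R[i]^o)); split; first exact: ualg_cst.
    by rewrite big_nil.
  move=> t l; rewrite !big_nil (_ : cfun_cst cK (0 : R[i]^o) t = 0) //.
  by rewrite !(mulr0, subr0, addr0).
have [|h [Bh ht0 hP]] := IHs; first by move=> k ks; apply: Bs; rewrite inE ks orbT.
exists ((conjc (g t0) : R[i]) *: g + h); split.
- by apply: (ualg_linear hB) => //; apply: Bs; rewrite inE eqxx.
- rewrite cfunDE cfunZE ht0 !big_cons rmorphD /= sqr_rnorm; congr (_ + _).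
  by case: (g t0) => x y; apply/eqP; rewrite eq_complex /=; apply/andP; split;
     apply/eqP; ring.
move=> t l; have [h1 h2] := hP t l; rewrite !big_cons cfunDE cfunZE.
split.
  have : 0 <= cnorm (g t - l * g t0) ^+ 2 by rewrite sqr_ge0.
  move: h1; rewrite !sqr_rnorm.
  move: (g t) (g t0) (h t) l {h2} => [x y] [x0 y0] [u v] [a b] /=.
  by set S1 := \sum_(_ <- _) _; set S2 := \sum_(_ <- _) _; nra.
move: h2; rewrite !sqr_rnorm => ->.
by move: (g t) (g t0) (h t) => [x y] [x0 y0] [u v] /=; ring.
Qed.

(* The point of K whose value vector lies farthest from the origin is exposed
   by the inner product with that vector. *)
Lemma peak_at_farthest (s : seq C) (t0 : K) : (forall g, g \in s -> B g) ->
  (forall t, sqsum s t <= sqsum s t0) -> 0 < sqsum s t0 ->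
  exists f, [/\ B f, f t0 = 1, forall t, cnorm (f t) <= 1 &
    forall t, sqdist s t t0 <= 2 * sqsum s t0 * cnorm (f t - 1)].
Proof.
move=> Bs smax N0; have [h [Bh ht0 hP]] := inner_product_fun t0 Bs.
set N := sqsum s t0 in smax N0 ht0 hP *.
pose f : C := (N^-1)%:C *: h + cfun_cst cK (0 : R[i]^o).
have fE t : f t = (N^-1)%:C * h t by rewrite cfunDE cfunZE addr0.
have hE t : h t = N%:C * f t.
  by rewrite fE mulrA -rmorphM divff ?gt_eqF // mul1r.
exists f; split.
- by apply: (ualg_linear hB) => //; exact: ualg_cst.
- by rewrite fE ht0 -rmorphM mulVf ?gt_eqF.
(* The choice [l = f t] turns positivity into N |f(t)|^2 <= [sqsum s t], which is at most N. *)
- move=> t; have [+ _] := hP t (f t); rewrite hE.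
  rewrite sqr_rnorm => h1; have h2 := smax t.
  rewrite -(ler_pXn2r (ltn0Sn 1)) ?nnegrE ?rnorm_ge0 // expr1n sqr_rnorm.
  rewrite -(ler_pM2l N0) mulr1; move: h1 h2.
  by case: (f t) => x y /=; lra.
- move=> t; have [_ ->] := hP t 0; rewrite hE.
  have := smax t; have := Re_le_rnorm (1 - f t).
  rewrite rnorm_distC.
  by case: (f t) => x y /= h1 h2; nra.
Qed.

End UniformAlgebra.

(** * Peaking for vector-valued functions *)

Section VectorValued.
Context {X : normedModType R[i]} {A : submodClosed (cfun cK X)}.
Context (hA : vector_function_space A).
Implicit Type h : cfun cK X.

Local Notation B := (base_algebra A).

Lemma cfun_net h (e : R) : 0 < e -> exists P : seq K, forall t,
  exists2 p, p \in P & rnorm (h t - h p) < e.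
Proof.
move=> e0.
(* The filter of lists directed by inclusion: compactness as near-covering then yields one list for
   all points. *)
pose F : set_system (seq K) :=
  [set S | exists P0 : seq K, forall P : seq K, {subset P0 <= P} -> S P].
have FF : Filter F.
  split; first by exists [::].
    move=> S S' [P SP] [P' SP']; exists (P ++ P') => Q PQ; split.
      by apply: SP => t tP; apply: PQ; rewrite mem_cat tP.
    by apply: SP' => t tP; apply: PQ; rewrite mem_cat tP orbT.
  by move=> S S' SS' [P SP]; exists P => Q /SP /SS'.
pose near_net (P : seq K) t := exists2 p, p \in P & rnorm (h t - h p) < e.
have [|P PP] := (compact_near_coveringP setT).1 cK _ F near_net FF; last first.
  by exists P => t; exact: (PP P).
move=> p _; pose G := fun t => rnorm (h t - h p).
exists ([set t | G t < e], [set P : seq K | p \in P]).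
  split; last by exists [:: p] => P; apply; rewrite inE.
  have cG : continuous G.
    move=> t; apply: (@continuous_comp _ _ _ (fun t => h t - h p) (@rnorm R X)).
      by apply: cvgB; [exact: cfun_continuous|exact: cvg_cst].
    exact: rnorm_continuous.
  apply: (cG p [set x | x < e]); apply: open_nbhs_nbhs; split; first exact: open_lt.
  by rewrite /= /G subrr rnorm0.
by move=> [t P] /= [tp pP]; exists p.
Qed.

Lemma base_algebra_comp h (phi : {linear X -> R[i]^o}) : h \in A ->
  continuous phi -> exists2 g, B g & forall t, g t = phi (h t).
Proof.
move=> Ah cphi.
have cg : continuous (fun t => phi (h t) : R[i]^o).
  move=> t; apply: (@continuous_comp _ _ _ h phi); last exact: cphi.
  exact: cfun_continuous.
by exists (mkcfun cK cg) => //; exists h, phi; split.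
Qed.

(** Functionals norming the differences of the values of [h] on a finite net, composed with [h],
    control its oscillation. *)
Lemma scalar_family h (e : R) : h \in A -> 0 < e ->
  exists2 s : seq (cfun cK R[i]^o), (forall g, g \in s -> B g) &
  exists2 d : R, 0 < d &
    forall t t0, sqdist s t t0 <= d -> rnorm (h t - h t0) <= e.
Proof.
(* Two fifths go to approximating [h t] and [h t0] on the net, three to the distance between the two
   net values. *)
move=> Ah e0; have e5 : 0 < e / 5 by rewrite divr_gt0.
have [P Ph] := cfun_net h e5.
have gP (pq : K * K) : exists g, B g /\ exists phi : {linear X -> R[i]^o},
    [/\ forall x, rnorm (phi x) <= rnorm x,
        phi (h pq.1 - h pq.2) = (rnorm (h pq.1 - h pq.2))%:C &
        forall t, g t = phi (h t)].
  have [phi [cphi phi1 phiE]] := hahn_banach (h pq.1 - h pq.2).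
  have [g Bg gE] := base_algebra_comp Ah cphi.
  by exists g; split=> //; exists phi.
pose G pq := sval (cid (gP pq)).
exists [seq G (p, q) | p <- P, q <- P].
  move=> _ /allpairsP[[p q] [_ _ ->]]; exact: (svalP (cid (gP (p, q)))).1.
exists ((e / 5) ^+ 2) => [|t t0 tt0]; first by rewrite exprn_gt0.
have [p pP tp] := Ph t; have [q qP t0q] := Ph t0.
have [_ [phi [phi1 phiE GE]]] := svalP (cid (gP (p, q))).
rewrite -/(G (p, q)) /= in GE phiE.
have Gtt0 : rnorm (phi (h t) - phi (h t0)) <= e / 5.
  rewrite -(ler_pXn2r (ltn0Sn 1)) ?nnegrE ?rnorm_ge0 ?(ltW e5) //.
  apply: le_trans tt0; rewrite -!GE /sqdist.
  have : G (p, q) \in [seq G (p, q) | p <- P, q <- P].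
    by apply/allpairsP; exists (p, q).
  elim: [seq _ | _ <- _, _ <- _] => // g s IHs; rewrite inE big_cons.
  move=> /orP[/eqP <-|/IHs gs]; first by rewrite lerDl sumr_ge0 // => *; rewrite sqr_ge0.
  by rewrite (le_trans gs) // lerDr sqr_ge0.
have pq : rnorm (h p - h q) <= rnorm (h t - h p) + e / 5 + rnorm (h t0 - h q).
  rewrite -[leLHS]ger0_norm ?rnorm_ge0 // -rnormR -phiE.
  rewrite (_ : h p - h q = - (h t - h p) + (h t - h t0) + (h t0 - h q)); last first.
    by rewrite opprB !subrKA.
  have phiD a b c : phi (- a + b + c) = - phi a + phi b + phi c.
    by rewrite !linearD linearN.
  rewrite phiD; apply: le_trans (rnormD _ _) _.
  apply: lerD; last exact: phi1.
  apply: le_trans (rnormD _ _) _; apply: lerD; last by rewrite linearB.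
  by rewrite rnormN; exact: phi1.
rewrite (_ : h t - h t0 = (h t - h p) + (h p - h q) - (h t0 - h q)); last first.
  by rewrite subrKA opprB subrKA.
apply: le_trans (rnormD _ _) _; rewrite rnormN.
by have := rnormD (h t - h p) (h p - h q); lra.
Qed.

(** The family controlling [h] is enlarged by [b], a scalar function norming [q] plus a large
    constant [M]; where the sum of squares is maximal, |b| and hence |q| are nearly maximal. *)
Lemma peaking (q h : cfun cK X) (e : R) (t1 : K) : q \in A -> h \in A -> 0 < e ->
  exists t0 f, exists2 d : R, 0 < d &
  [/\ B f, f t0 = 1, forall t, cnorm (f t) <= 1, rnorm q - e <= rnorm (q t0) &
      forall t, cnorm (f t - 1) <= d -> rnorm (h t - h t0) <= e].
Proof.
move=> Aq Ah e0; have hB := vfs_ualg hA.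
have [ts tsP] : exists ts, forall t, rnorm (q t) <= rnorm (q ts).
  apply: (continuous_max t1 (f := fun t => rnorm (q t))) => t.
  apply: (@continuous_comp _ _ _ q (@rnorm R X)); last exact: rnorm_continuous.
  exact: cfun_continuous.
have qts : rnorm q <= rnorm (q ts) by apply: supnorm_le; rewrite ?rnorm_ge0.
have [phi [cphi phi1 phiE]] := hahn_banach (q ts).
have [a Ba aE] := base_algebra_comp Aq cphi.
have [s Bs [d d0 sP]] := scalar_family Ah e0.
have [tL tLP] := continuous_max t1 (sqsum_continuous (s := s)).
set L := sqsum s tL in tLP; have L0 : 0 <= L := sqsum_ge0 s tL.
(* If the norm of [q t0] fell short by more than [e], the square of |b| would lose more than
   [2 * e * M], which exceeds the gain of at most [L] from [s]. *)
pose M := L / (2 * e) + 1.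
have M0 : 0 < M by rewrite ltr_wpDl // divr_ge0 // mulr_ge0 // ltW.
pose b := a + cfun_cst cK (M%:C : R[i]^o).
have Bb : B b by apply: (ualgD hB) => //; exact: ualg_cst.
have bE t : b t = phi (q t) + M%:C by rewrite -aE.
pose s' := b :: s.
have Bs' g : g \in s' -> B g.
  by rewrite inE => /orP[/eqP ->//|]; exact: Bs.
have [t0 t0P] := continuous_max t1 (sqsum_continuous (s := s')).
have s'E t : sqsum s' t = cnorm (b t) ^+ 2 + sqsum s t by rewrite /sqsum big_cons.
have bts : cnorm (b ts) = rnorm (q ts) + M.
  rewrite bE phiE -rmorphD rnormR ger0_norm //.
  by rewrite addr_ge0 ?rnorm_ge0 // ltW.
have bt0 : cnorm (b t0) <= rnorm (q t0) + M.
  rewrite bE; apply: le_trans (rnormD _ _) _; apply: lerD; first exact: phi1.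
  by rewrite rnormR gtr0_norm.
have N0 : 0 < sqsum s' t0.
  apply: lt_le_trans (t0P ts); rewrite s'E bts ltr_pwDl ?sqsum_ge0 //.
  by rewrite exprn_gt0 // ltr_wpDl ?rnorm_ge0.
have [f [Bf ft0 f1 fP]] := peak_at_farthest hB Bs' t0P N0.
exists t0, f, (d / (2 * sqsum s' t0)); first by rewrite divr_gt0 // mulr_gt0.
split=> //.
  have h1 := t0P ts; rewrite !s'E bts in h1.
  have h2 := tLP t0; have h3 := sqsum_ge0 s ts.
  have h4 : cnorm (b t0) ^+ 2 <= (rnorm (q t0) + M) ^+ 2.
    by rewrite ler_pXn2r ?nnegrE ?rnorm_ge0 // addr_ge0 ?rnorm_ge0 // ltW.
  have LM : L <= 2 * e * M.
    by rewrite /M mulrDr mulr1 mulrC divfK ?lerDl ?mulr_ge0 ?ltW // gt_eqF // mulr_gt0.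
  apply: le_trans (_ : rnorm (q ts) - e <= _); first by rewrite lerD2r.
  have h5 := rnorm_ge0 (q t0); have h6 := rnorm_ge0 (q ts).
  have [//|h7] := leP (rnorm (q ts) - e) (rnorm (q t0)).
  nra.
move=> t; rewrite ler_pdivlMr ?mulr_gt0 // mulrC => fd; apply: sP.
apply: le_trans (le_trans (fP t) fd).
by rewrite /sqdist big_cons lerDr sqr_ge0.
Qed.

End VectorValued.
End PeakFunctions.

(** * Transfer of Lipschitz maps and their numerical radius to [X] *)

Section Transfer.
Context {R : realType} {X Z : normedModType R[i]}.
Implicit Types (x y : X) (T : Z -> Z).

Local Notation cnorm z := (rnorm (z : R[i]^o)).

Lemma duality_set_dual_norm x (phi : {linear X -> R[i]^o}) : x != 0 ->
  duality_set x phi -> dual_norm phi = rnorm x /\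
  (forall y, rnorm y <= 1 -> cnorm (phi y) <= rnorm x).
Proof.
move=> x0 [_ [-> /complexI]]; have n0 := rnorm_gt0 x0.
rewrite expr2 => /(mulIf (lt0r_neq0 n0)) dx; split=> // y y1.
rewrite -dx; apply: ub_le_sup; last by exists y.
(* Without a supremum, [dual_norm] would be the default 0, but it equals the positive number
   [rnorm x]. *)
have [//|Nsup] := pselect (has_sup
  [set cnorm (phi z) | z in [set z | rnorm z <= 1]]); first by case.
by move: n0; rewrite -dx /dual_norm sup_out // ltxx.
Qed.

(** As [ev] is contractive, the dual norm of the composition is at most the norm of [z]; it is
    attained at [z] normalized. *)
Lemma duality_set_comp (ev : {linear Z -> X}) z (phi : {linear X -> R[i]^o}) :
  (forall z, rnorm (ev z) <= rnorm z) -> rnorm (ev z) = rnorm z -> z != 0 ->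
  duality_set (ev z) phi -> duality_set z (phi \o ev : {linear Z -> R[i]^o}).
Proof.
move=> ev1 evz z0 phi_ev.
have ez0 : ev z != 0.
  apply/eqP => h; have := rnorm_gt0 z0.
  by rewrite -evz h rnorm0 ltxx.
have [_ phi1] := duality_set_dual_norm ez0 phi_ev.
case: phi_ev => cphi [_ phiE].
have n0 := rnorm_gt0 z0; rewrite evz in phi1 phiE.
split.
  rewrite /continuous_dual /= => w; apply: (@continuous_comp _ _ _ ev phi).
    exact: contraction_continuous.
  exact: cphi.
suff dn : dual_norm (phi \o ev : {linear Z -> R[i]^o}) = rnorm z.
  by split; rewrite ?dn /= phiE // expr2.
have ub w : rnorm w <= 1 -> cnorm (phi (ev w)) <= rnorm z.
  by move=> w1; apply: phi1; exact: le_trans (ev1 w) w1.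
apply: le_anti; apply/andP; split.
  apply: ge_sup; first by exists (cnorm (phi (ev 0))), 0 => //=; rewrite rnorm0.
  by move=> _ [w /= w1 <-]; exact: ub.
apply: ub_le_sup; first by exists (rnorm z) => _ [w /= w1 <-]; exact: ub.
have nV : 0 <= (rnorm z)^-1 by rewrite invr_ge0 ltW.
exists ((rnorm z)^-1%:C *: z) => /=.
  by rewrite rnormZR // mulVf // gt_eqF.
rewrite !linearZZ phiE rnormZ !rnormR !ger0_norm ?exprn_ge0 // ?ltW //.
by rewrite expr2 mulKf // gt_eqF.
Qed.

Lemma lipschitz_le (S : X -> X) (k : R) :
  (forall x y, rnorm (S x - S y) <= k * rnorm (x - y)) -> lipschitz S.
Proof.
move=> Sk; apply: (@klipschitzW _ _ _ k%:C).
  exact: (@globally_properfilter _ _ (0, 0)).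
by move=> [x y] _ /=; rewrite -!rnormE -rmorphM lecR.
Qed.

(** Division by the exact Lipschitz constant, since the index ranges over maps of norm exactly 1;
    the given pair of points keeps that constant at least [k]. *)
Lemma lip_norm_normalize (S : X -> X) (k : R) x0 y0 : x0 != y0 -> 0 < k ->
  k * rnorm (x0 - y0) <= rnorm (S x0 - S y0) ->
  (forall x y, rnorm (S x - S y) <= rnorm (x - y)) ->
  exists2 l : R, k <= l & lip_norm (fun x => (l^-1)%:C *: S x) = 1%E.
Proof.
move=> xy0 k0 Sk S1.
have pos x y : x != y -> 0 < rnorm (x - y).
  by move=> xy; apply: rnorm_gt0; rewrite subr_eq0.
pose D := [set p : X * X | p.1 != p.2].
pose q (U : X -> X) (p : X * X) := rnorm (U p.1 - U p.2) / rnorm (p.1 - p.2).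
pose E U := [set q U p | p in D].
have E0 U : E U !=set0 by exists (q U (x0, y0)), (x0, y0).
have q1 p : D p -> q S p <= 1.
  by case: p => x y /= xy; rewrite /q ler_pdivrMr ?mul1r ?S1 ?pos.
have ubS : has_ubound (E S) by exists 1 => _ [p Dp <-]; exact: q1.
pose l := sup (E S).
have kl : k <= l.
  apply: le_trans (ub_le_sup ubS _); last by exists (x0, y0).
  by rewrite /q ler_pdivlMr // pos.
have l0 : 0 < l by exact: lt_le_trans kl.
exists l => //; pose S' x := (l^-1)%:C *: S x.
have q' p : q S' p = q S p / l.
  rewrite /q /S' -scalerBr rnormZR ?invr_ge0 ?(ltW l0) //.
  by rewrite -mulrA mulrC.
have ub' : has_ubound (E S').
  exists 1 => _ [p Dp <-]; rewrite q' ler_pdivrMr // mul1r.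
  by apply: ub_le_sup => //; exists p.
rewrite /lip_norm (_ : [set _ | _] = EFin @` E S'); last first.
  apply/seteqP; split=> [_ [x [y [xy ->]]]|_ [_ [[x y] /= xy <-] <-]].
    by exists (q S' (x, y)) => //; exists (x, y).
  by exists x, y.
rewrite ereal_sup_EFin //; congr (_%:E); apply: le_anti; apply/andP; split.
  apply: ge_sup => // _ [p Dp <-]; rewrite q' ler_pdivrMr // mul1r.
  by apply: ub_le_sup => //; exists p.
rewrite -(ler_pM2r l0) mul1r; apply: ge_sup => // _ [p Dp <-].
rewrite -ler_pdivrMr // -q'; by apply: ub_le_sup => //; exists p.
Qed.

(** Functionals in the duality set of [x - y] pull back along [ev] to that of [Phi x - Phi y], so
    the radius of [S] is at most that of [T]; normalizing [S] costs at most a factor [k^-1]. *)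
Lemma lip_numerical_index_transfer (ev : {linear Z -> X}) (Phi : X -> Z) T
    (k v : R) x0 y0 :
  (forall z, rnorm (ev z) <= rnorm z) ->
  (forall x y, ev (Phi x - Phi y) = x - y) ->
  (forall x y, rnorm (Phi x - Phi y) = rnorm (x - y)) ->
  (forall z w, rnorm (T z - T w) <= rnorm (z - w)) ->
  0 < k -> x0 != y0 ->
  k * rnorm (x0 - y0) <= rnorm (ev (T (Phi x0) - T (Phi y0))) ->
  (lip_numerical_radius T <= v%:E)%E ->
  (lip_numerical_index X <= (v / k)%:E)%E.
Proof.
move=> ev1 evPhi Phi1 T1 k0 xy0 kT Tv.
pose S x := ev (T (Phi x) - T (Phi 0)).
have SE x y : S x - S y = ev (T (Phi x) - T (Phi y)).
  by rewrite /S -linearB opprB addrA subrK.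
have S1 x y : rnorm (S x - S y) <= rnorm (x - y).
  by rewrite SE (le_trans (ev1 _)) // -Phi1 T1.
have [|l kl l1] := lip_norm_normalize xy0 k0 _ S1; first by rewrite SE.
have l0 : 0 < l by exact: lt_le_trans kl.
have lV : 0 <= l^-1 by rewrite invr_ge0 ltW.
pose S' x := (l^-1)%:C *: S x.
apply: ge_ereal_inf; exists (lip_numerical_radius S'); last first.
  apply: ge_ereal_sup => _ [x [y [phi [xy phiD ->]]]].
  rewrite lee_fin /S' -scalerBr linearZZ rnormZ rnormR ger0_norm // SE.
  have PhiN : Phi x - Phi y != 0.
    apply: contra xy => /eqP Phi0; rewrite -subr_eq0; apply/eqP/rnorm_eq0.
    by rewrite -Phi1 Phi0 rnorm0.
  have phi_ev : duality_set (Phi x - Phi y) (phi \o ev : {linear Z -> R[i]^o}).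
    by apply: duality_set_comp => //; rewrite evPhi.
  have : ((cnorm (phi (ev (T (Phi x) - T (Phi y)))) / rnorm (x - y) ^+ 2)%:E
      <= v%:E)%E.
    apply: le_trans Tv; apply: ereal_sup_ubound.
    exists (Phi x), (Phi y), (phi \o ev : {linear Z -> R[i]^o}).
    by rewrite Phi1; split=> //; rewrite -subr_eq0.
  rewrite lee_fin => h; rewrite -mulrA mulrC.
  apply: ler_pM => //; first by rewrite mulr_ge0 ?rnorm_ge0 // invr_ge0 exprn_ge0 ?rnorm_ge0.
  by rewrite lef_pV2.
exists S' => //; split=> //; split.
  apply: (@lipschitz_le S' l^-1) => x y.
  by rewrite /S' -scalerBr rnormZR // ler_wpM2l.
by rewrite /S' /S subrr linear0 scaler0.
Qed.

End Transfer.

(** The weights of [c] as a convex combination of 1 and -1; positivity of [l] keeps the first of the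
    two segments nondegenerate. *)
Lemma balanced_weight (R : realFieldType) (c : R) : 0 <= c -> c <= 1 ->
  exists l, [/\ 0 < l, 0 <= 1 - l & l - (1 - l) = c].
Proof. by move=> c0 c1; exists ((1 + c) / 2); split; lra. Qed.

(** * Isometric copies of [X] in A(K, X) and segments inside them *)

Section FunctionSpace.
Context {R : realType} {K : topologicalType} {cK : compact [set: K]}.
Context {X : normedModType R[i]} {A : submodClosed (cfun cK X)}.
Context (hA : vector_function_space A).
Implicit Types (x y : X) (t : K).

Local Notation cnorm z := (rnorm (z : R[i]^o)).
Local Notation Z := (subspace_of A).
Local Notation B := (base_algebra A).

Definition point_eval_fun t (z : Z) : X := (\val z) t.

Lemma point_eval_linear t : linear (point_eval_fun t).
Proof. by move=> a x y; rewrite /point_eval_fun linearP. Qed.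

Definition point_eval t : {linear Z -> X} :=
  HB.pack (point_eval_fun t)
    (GRing.isLinear.Build _ _ _ _ (point_eval_fun t) (point_eval_linear t)).

Lemma rnorm_point_eval t (z : Z) : rnorm (point_eval t z) <= rnorm z.
Proof. exact: rnorm_le_supnorm. Qed.

Lemma rnorm_subspace_le (z : Z) (M : R) : 0 <= M ->
  (forall t, rnorm (point_eval t z) <= M) -> rnorm z <= M.
Proof. exact: supnorm_le. Qed.

(** The bound |phi| + |psi| <= 1 controls the norm from above; evaluation at [t0], where [psi] has
    to vanish, controls it from below. *)
Lemma affine_embedding (t0 : K) (phi psi : cfun cK R[i]^o) (h G : Z) (r : R)
    (chi : {linear X -> R[i]^o}) :
  B phi -> B psi -> 0 < r -> rnorm h <= r ->
  phi t0 = 1 -> (forall t, cnorm (phi t) + cnorm (psi t) <= 1) ->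
  (forall x, cnorm (chi x) <= rnorm x) ->
  exists Phi : X -> Z,
  [/\ forall x t, point_eval t (Phi x) =
        point_eval t G + ((chi x : R[i]) * (r^-1)%:C * psi t) *: point_eval t h + phi t *: x,
      forall x y, point_eval t0 (Phi x - Phi y) = x - y &
      forall x y, rnorm (Phi x - Phi y) = rnorm (x - y)].
Proof.
move=> Bphi Bpsi r0 hr phi0 pp1 chi1.
have psi0 : psi t0 = 0.
  apply: rnorm_eq0; apply: le_anti; rewrite rnorm_ge0 andbT.
  by have := pp1 t0; rewrite phi0 cnorm1 => ?; lra.
pose L x : cfun cK X := \val G + ((chi x : R[i]) * (r^-1)%:C) *: cfun_scale psi (\val h)
   + cfun_scale phi (cfun_cst cK x).
have LA x : L x \in A.
  apply: rpredD; last exact: (vfs_tensor hA).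
  apply: rpredD; first exact: (valP G).
  by apply: rpredZ; apply: (vfs_mul hA) => //; exact: (valP h).
pose Phi x : Z := exist _ (L x) (LA x).
have PhiE x t : point_eval t (Phi x) = point_eval t G
    + ((chi x : R[i]) * (r^-1)%:C * psi t) *: point_eval t h + phi t *: x.
  by rewrite -scalerA.
have PhiB x y t : point_eval t (Phi x - Phi y) =
    ((chi (x - y) : R[i]) * (r^-1)%:C * psi t) *: point_eval t h + phi t *: (x - y).
  have cancelG (g p q p' q' : X) : g + p + q - (g + p' + q') = p - p' + (q - q').
    by rewrite -[g + p + q]addrA -[g + p' + q']addrA opprD addrACA subrr add0r
       opprD addrACA.
  by rewrite linearB !PhiE cancelG linearB !mulrBl scalerBl scalerBr.
have Phi0 x y : point_eval t0 (Phi x - Phi y) = x - y.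
  by rewrite PhiB psi0 phi0 mulr0 scale0r add0r scale1r.
exists Phi; split=> // x y; apply: le_anti; apply/andP; split; last first.
  by rewrite -[in leLHS]Phi0 rnorm_point_eval.
apply: rnorm_subspace_le => [|t]; first exact: rnorm_ge0.
rewrite PhiB; set w := x - y; apply: le_trans (rnormD _ _) _.
rewrite !rnormZ rnormR ger0_norm ?invr_ge0 ?(ltW r0) //.
have ht : rnorm (point_eval t h) <= r by exact: le_trans (rnorm_point_eval t h) hr.
have rh : r^-1 * rnorm (point_eval t h) <= 1 by rewrite mulrC ler_pdivrMr // mul1r.
have rh0 : 0 <= r^-1 * rnorm (point_eval t h).
  by rewrite mulr_ge0 ?rnorm_ge0 // invr_ge0 ltW.
have c1 := chi1 w; have c0 := @rnorm_ge0 R R[i]^o (chi w).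
have p0 := @rnorm_ge0 R R[i]^o (psi t).
have crh : cnorm (chi w) * (r^-1 * rnorm (point_eval t h)) <= rnorm w * 1.
  by rewrite ler_pM.
have := ler_wpM2r p0 crh; have := ler_wpM2r (rnorm_ge0 w) (pp1 t).
lra.
Qed.

(** The error is (phi + psi - 1) h + phi (h(t0) - h): near the peak h(t0) - h is small, elsewhere
    phi is. *)
Lemma stolz_functions (q h : Z) (r e : R) (t1 : K) :
  0 < r -> rnorm h <= r -> 0 < e ->
  exists t0 (phi psi : cfun cK R[i]^o),
  [/\ B phi /\ B psi, phi t0 = 1,
      forall t, cnorm (phi t) + cnorm (psi t) <= 1,
      rnorm q - e <= rnorm (point_eval t0 q) &
      forall t, rnorm (psi t *: point_eval t h + phi t *: point_eval t0 h
                       - point_eval t h) <= e].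
Proof.
(* Of [3 * r + 1], one [r] pays for the term with phi + psi - 1; the remaining [2 * r + 1] covers
   both cases of the other term. *)
move=> r0 hr e0; pose d0 := e / (3 * r + 1).
have r31 : 0 < 3 * r + 1 by rewrite addr_gt0 // mulr_gt0.
have e'0 : 0 < d0 by rewrite divr_gt0.
have eE : d0 * (3 * r + 1) = e by rewrite divfK // gt_eqF.
have d0e : d0 <= e by rewrite -eE ler_peMr ?(ltW e'0) // lerDr mulr_ge0 // ltW.
have [t0 [f [d dp [Bf ft0 f1 qt0 fh]]]] := peaking hA t1 (valP q) (valP h) e'0.
have [P [S [P1 PS]]] := stolz_pair dp e'0.
have hB := vfs_ualg hA.
have [phi Bphi phiE] := ualg_horner hB P Bf.
have [psi Bpsi psiE] := ualg_horner hB S Bf.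
have pp1 t : cnorm (phi t) + cnorm (psi t) <= 1.
  by rewrite phiE psiE; case: (PS _ (f1 t)).
exists t0, phi, psi; split=> //; first by rewrite phiE ft0.
  by apply: le_trans qt0; rewrite lerD2l lerN2.
move=> t; set ht := point_eval t h; set u := point_eval t0 h.
have ppe : cnorm (phi t + psi t - 1) <= d0.
  by rewrite phiE psiE; case: (PS _ (f1 t)).
have phi_far : d <= cnorm (f t - 1) -> cnorm (phi t) <= d0.
  by rewrite phiE; case: (PS _ (f1 t)).
have ur : rnorm u <= r by exact: le_trans (rnorm_point_eval _ _) hr.
have htr : rnorm ht <= r by exact: le_trans (rnorm_point_eval _ _) hr.
have near : cnorm (f t - 1) <= d -> rnorm (u - ht) <= d0.
  by rewrite [rnorm (u - ht)]rnorm_distC; exact: fh.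
have phi1 : cnorm (phi t) <= 1.
  by apply: le_trans (pp1 t); rewrite lerDl rnorm_ge0.
move: (f t) (phi t) (psi t) ht u => z p s w u in near phi_far ppe phi1 ur htr *.
have swap (a b c w' : X) : b + c - w' = a + b - w' + (c - a).
  by rewrite -[a + b - w']addrA [RHS]addrC subrKA addrA [c + b]addrC.
rewrite (swap (p *: w)) -scalerDl -[X in _ - X + _]scale1r -scalerBl -scalerBr.
apply: le_trans (rnormD _ _) _; rewrite !rnormZ.
have : cnorm (p + s - 1) * rnorm w <= d0 * r by rewrite ler_pM ?rnorm_ge0.
suff : cnorm p * rnorm (u - w) <= d0 * (2 * r + 1) by rewrite -eE; lra.
have [/ltW/near uw|far] := ltP (cnorm (z - 1)) d.
  apply: le_trans (_ : 1 * d0 <= _); first by rewrite ler_pM ?rnorm_ge0.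
  by rewrite mul1r ler_peMr ?(ltW e'0) // lerDr mulr_ge0 // ltW.
have uw : rnorm (u - w) <= 2 * r.
  by apply: le_trans (rnormD _ _) _; rewrite rnormN; lra.
apply: le_trans (_ : d0 * (2 * r) <= _); last by rewrite ler_pM2l // lerDl.
by rewrite ler_pM ?rnorm_ge0 ?phi_far.
Qed.

Lemma real_multiple_on_sphere (u v : X) (r : R) : v != 0 -> 0 < r ->
  rnorm u <= r -> exists x (c : R),
  [/\ rnorm x = r, 0 <= c <= 1 & u = c%:C *: x].
Proof.
move=> v0 r0 ur; have nV (w : X) : w != 0 -> rnorm ((r / rnorm w)%:C *: w) = r.
  move=> /rnorm_gt0 w0.
  by rewrite rnormZR ?divr_ge0 ?ltW // divfK // gt_eqF.
have [->|u0] := eqVneq u 0.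
  by exists ((r / rnorm v)%:C *: v), 0; rewrite nV // lexx ler01 scale0r.
exists ((r / rnorm u)%:C *: u), (rnorm u / r); rewrite nV //; split=> //.
  by rewrite divr_ge0 ?rnorm_ge0 ?(ltW r0) // ler_pdivrMr // mul1r.
have nu := rnorm_gt0 u0.
by rewrite scalerA -rmorphM mulrA divfK ?divff ?gt_eqF // scale1r.
Qed.

(* The segments G -> Phi2 0 = Phi1 x1 -> Phi2 x2 have directions attaining their norms
   at [t0] and total length [rnorm h], so that a map T which nearly attains its Lipschitz
   norm on F = G + h does so on one of them. *)
Lemma two_segments (t0 : K) (phi psi : cfun cK R[i]^o) (h G : Z) :
  B phi -> B psi -> h != 0 ->
  phi t0 = 1 -> (forall t, cnorm (phi t) + cnorm (psi t) <= 1) ->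
  exists (Phi1 Phi2 : X -> Z) x1 x2,
  [/\ forall x y, point_eval t0 (Phi1 x - Phi1 y) = x - y /\
        rnorm (Phi1 x - Phi1 y) = rnorm (x - y),
      forall x y, point_eval t0 (Phi2 x - Phi2 y) = x - y /\
        rnorm (Phi2 x - Phi2 y) = rnorm (x - y),
      Phi1 0 = G /\ Phi2 0 = Phi1 x1, x1 != 0 /\ rnorm x1 + rnorm x2 = rnorm h &
      forall t, point_eval t (Phi2 x2 - G) =
        psi t *: point_eval t h + phi t *: point_eval t0 h].
Proof.
move=> Bphi Bpsi h0 phi0 pp1; pose r := rnorm h.
have r0 : 0 < r by exact: rnorm_gt0.
have [t1 ht1] : exists t1, point_eval t1 h != 0.
  apply: contrapT => hN; case/eqP: h0; apply/val_inj/val_inj/funext => t.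
  by apply: contrapT => ht; apply: hN; exists t; apply/eqP.
have [x1 [c [x1r /andP[c0 c1] uE]]] :=
  real_multiple_on_sphere ht1 r0 (rnorm_point_eval t0 h).
have [chi [_ chi1 chix1]] := hahn_banach x1; rewrite x1r in chix1.
have Nchi1 x : cnorm ((\- chi) x) <= rnorm x by rewrite /= rnormN.
have [l [l0 l1 lc]] := balanced_weight c0 c1.
have [Phi1 [Phi1E Phi1t0 Phi1N]] :=
  affine_embedding G Bphi Bpsi r0 (lexx r) phi0 pp1 chi1.
pose M := Phi1 (l%:C *: x1).
have [Phi2 [Phi2E Phi2t0 Phi2N]] :=
  affine_embedding M Bphi Bpsi r0 (lexx r) phi0 pp1 Nchi1.
have Phi10 : Phi1 0 = G.
  apply/val_inj/val_inj/funext => t; have := Phi1E 0 t.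
  by rewrite linear0 !mul0r scale0r scaler0 !addr0.
have Phi20 : Phi2 0 = M.
  apply/val_inj/val_inj/funext => t; have := Phi2E 0 t.
  by rewrite linear0 !mul0r scale0r scaler0 !addr0.
(* Under [chi] and [\- chi] the two vectors give psi h the weights l and 1 - l, of sum 1, while the
   vectors themselves add up to c x1 = h(t0). *)
exists Phi1, Phi2, (l%:C *: x1), (- ((1 - l)%:C *: x1)); split=> //.
  split.
    apply: contraTneq (mulr_gt0 l0 r0) => lx0.
    by rewrite -x1r -rnormZR ?(ltW l0) // lx0 rnorm0 ltxx.
  by rewrite rnormN !rnormZR ?(ltW l0) // x1r -mulrDl addrC subrK mul1r.
move=> t; have rr : r%:C * (r^-1)%:C = 1 :> R[i].
  by rewrite -rmorphM divff // gt_eqF.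
have chi_l : (chi (l%:C *: x1) : R[i]) * (r^-1)%:C = l%:C.
  by rewrite linearZZ chix1 -mulrA rr mulr1.
have chi_l' : ((\- chi) (- ((1 - l)%:C *: x1)) : R[i]) * (r^-1)%:C = (1 - l)%:C.
  by rewrite /= linearN opprK linearZZ chix1 -mulrA rr mulr1.
have cancelG (g p q' p' q'' : X) : g + p + q' + p' + q'' - g = p + p' + (q' + q'').
  by rewrite -!addrA addrC -!addrA addNr addr0; congr (_ + _); rewrite addrCA.
rewrite linearB Phi2E Phi1E chi_l chi_l' cancelG uE.
have l2 : l%:C + (1 - l)%:C = 1 by rewrite -rmorphD addrC subrK.
rewrite -scalerDl -mulrDl l2 mul1r -scalerDr -scalerBl.
by rewrite -(rmorphB _ l (1 - l)) lc.
Qed.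

(** The endpoint [E] of the two segments is close to [F], so [T E - T G] is still nearly extremal at
    [t0]; the triangle inequality through [M] passes this to one segment, as the lengths add up to
    the norm of [h]. *)
Lemma near_extremal_segment (T : Z -> Z) (F G : Z) (k : R) :
  (forall z w, rnorm (T z - T w) <= rnorm (z - w)) -> F != G -> 0 < k ->
  k * rnorm (F - G) < rnorm (T F - T G) ->
  exists t0 (Phi : X -> Z) x0 y0,
  [/\ forall x y, point_eval t0 (Phi x - Phi y) = x - y,
      forall x y, rnorm (Phi x - Phi y) = rnorm (x - y), x0 != y0 &
      k * rnorm (x0 - y0) <= rnorm (point_eval t0 (T (Phi x0) - T (Phi y0)))].
Proof.
move=> T1 FG k0 kFG; set h := F - G in kFG; set q := T F - T G in kFG.
have h0 : h != 0 by rewrite subr_eq0.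
have [t1 _] : exists t1 : K, True.
  apply: contrapT => KN; case/eqP: h0; apply/val_inj/val_inj/funext => t.
  by case: KN; exists t.
(* One half of the slack pays for evaluating at [t0], the other for replacing [F] by [E]. *)
pose e := (rnorm q - k * rnorm h) / 2.
have e0 : 0 < e by rewrite divr_gt0 // subr_gt0.
have [t0 [phi [psi [[Bphi Bpsi] phi0 pp1 qt0 approx]]]] :=
  stolz_functions q t1 (rnorm_gt0 h0) (lexx _) e0.
have [Phi1 [Phi2 [x1 [x2 [P1 P2 [Phi10 Phi20] [x10 len] sumE]]]]] :=
  two_segments G Bphi Bpsi h0 phi0 pp1.
set M := Phi1 x1 in Phi20; set E := Phi2 x2 in sumE.
have EF : rnorm (E - F) <= e.
  apply: rnorm_subspace_le => [|t]; first exact: ltW.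
  rewrite (_ : E - F = E - G - h); last by rewrite opprB addrA subrK.
  by rewrite linearB sumE.
have TEG : k * rnorm h <= rnorm (point_eval t0 (T E - T M)) +
    rnorm (point_eval t0 (T M - T G)).
  have -> : k * rnorm h = rnorm q - e - e.
    by rewrite -addrA -opprD /e -splitr subKr.
  rewrite lerBlDr; apply: le_trans qt0 _.
  rewrite (_ : q = (T E - T M) + (T M - T G) + (T F - T E)); last first.
    by rewrite subrKA addrC subrKA.
  have TFE : rnorm (T F - T E) <= e by rewrite (le_trans (T1 _ _)) // rnorm_distC.
  rewrite linearD; apply: le_trans (rnormD _ _) _.
  apply: lerD; last exact: le_trans (rnorm_point_eval _ _) TFE.
  by rewrite linearD rnormD.
have [case1|case2] := leP (k * rnorm x1) (rnorm (point_eval t0 (T M - T G))).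
  exists t0, Phi1, x1, 0; split=> [x y|x y||].
  - exact: (P1 x y).1.
  - exact: (P1 x y).2.
  - exact: x10.
  - by rewrite Phi10 subr0.
have TEM : k * rnorm x2 < rnorm (point_eval t0 (T E - T M)).
  rewrite -(ltrD2r (k * rnorm x1)) -mulrDr [rnorm x2 + _]addrC len.
  by apply: le_lt_trans TEG _; rewrite ltrD2l.
exists t0, Phi2, x2, 0; split=> [x y|x y||].
- exact: (P2 x y).1.
- exact: (P2 x y).2.
- apply/eqP => x20; move: TEM; rewrite /E x20 Phi20 subrr linear0 rnorm0 ltNge.
  by rewrite mulr_ge0 ?rnorm_ge0 // ltW.
- by rewrite Phi20 subr0 ltW.
Qed.

End FunctionSpace.

(** * Maps of Lipschitz norm 1 and the conclusion *)

Section LipNormOne.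
Context {R : realType} {Z : normedModType R[i]} {T : Z -> Z}.
Context (T1 : lip_norm T = 1%E).

Lemma lip_norm1_le z w : rnorm (T z - T w) <= rnorm (z - w).
Proof.
have [->|zw] := eqVneq z w; first by rewrite !subrr !rnorm0.
have zw0 : 0 < rnorm (z - w) by apply: rnorm_gt0; rewrite subr_eq0.
rewrite -[leRHS]mul1r -ler_pdivrMr // -lee_fin -T1.
by apply: ereal_sup_ubound; exists z, w.
Qed.

Lemma lip_norm1_near (k : R) : k < 1 ->
  exists z w, z != w /\ k * rnorm (z - w) < rnorm (T z - T w).
Proof.
move=> k1; have : (k%:E < lip_norm T)%E by rewrite T1 lte_fin.
move=> /ereal_sup_gt[_ [z [w [zw ->]]]]; rewrite lte_fin => kzw.
exists z, w; split=> //; rewrite -ltr_pdivlMr //.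
by apply: rnorm_gt0; rewrite subr_eq0.
Qed.

End LipNormOne.

Lemma shrink_factor (R : realFieldType) (v e : R) : 0 < e ->
  exists k, [/\ 0 < k, k < 1 & v / k <= v + e].
Proof.
move=> e0; have [v0|v0] := leP v 0.
  by exists (1 / 2); split; [lra|lra|rewrite ler_pdivrMr; lra].
have ve : 0 < v + e by rewrite addr_gt0.
exists (v / (v + e)); split; first exact: divr_gt0.
  by rewrite ltr_pdivrMr // mul1r ltrDl.
by rewrite invfM invrK mulrA divff ?mul1r // gt_eqF.
Qed.

Theorem theorem3p12 (R : realType) (K : topologicalType)
    (cK : compact [set: K]) (hK : hausdorff_space K)
    (X : completeNormedModType R[i]) (A : submodClosed (cfun cK X))
    (hA : vector_function_space A) :
  (lip_numerical_index X <= lip_numerical_index (subspace_of A))%E.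
Proof.
apply: le_ereal_inf_tmp => _ [T [_ T1] <-].
(* With [k] close to 1 the bound [v / k] stays below [v + e]; infinite radii are treated
   afterwards. *)
have le_of_ub (v : R) : (lip_numerical_radius T <= v%:E)%E ->
    (lip_numerical_index X <= v%:E)%E.
  move=> Tv; apply/lee_addgt0Pr => e /(shrink_factor v)[k [k0 k1 vk]].
  apply: le_trans (_ : ((v / k)%:E <= _)%E); last by rewrite -EFinD lee_fin.
  have [F [G [FG kFG]]] := lip_norm1_near T1 k1.
  have [t0 [Phi [x0 [y0 [Phi_t0 PhiN xy0 kT]]]]] :=
    near_extremal_segment hA (lip_norm1_le T1) FG k0 kFG.
  exact: (lip_numerical_index_transfer (rnorm_point_eval t0) Phi_t0 PhiN
    (lip_norm1_le T1) k0 xy0 kT Tv).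
case: (lip_numerical_radius T) le_of_ub => [r||] le_of_ub.
- exact: le_of_ub.
- exact: leey.
(* For a radius -oo every real bounds the index of [X], which is then -oo too. *)
- case: (lip_numerical_index X) le_of_ub => [r||] le_of_ub //.
    by have := le_of_ub (r - 1) (leNye _); rewrite lee_fin leNgt gtrBl ltr01.
  by have := le_of_ub 0 (leNye _).
Qed.
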